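(* Let $G$ be a non-trivial profinite group. Then $G$ is Fitting-degenerate if and only if the following holds for every $x \in G \setminus \{1\}$: there is an open normal subgroup $K$ of $G$ (depending on $x$) such that $G/K$ is primitive and $xK \notin F^*(G/K)$.
   Context: Profinite groups are regarded as topological groups: subgroups are required to be closed, homomorphisms continuous, and generation means topological generation. For a profinite group $G$ and a prime $p$, $O_p(G)$ is the subgroup generated by all normal pro-$p$ subgroups of $G$; the Fitting subgroup $F(G)$ is the subgroup generated by the $O_p(G)$ for all primes $p$. A profinite group $Q$ is quasisimple if $Q$ is perfect and $Q/Z(Q)$ is simple. A component of $G$ is a subnormal quasisimple subgroup of $G$; the layer $E(G)$ is the subgroup generated by all components of $G$. The generalised Fitting subgroup $F^*(G)$ is the subgroup generated by $F(G)$ and $E(G)$. $G$ is Fitting-degenerate if $F^*(G)$ is trivial. A finite group $X$ is primitive if it has a maximal (proper) subgroup $H$ whose core $\bigcap_{g \in X} H^g$ is trivial. *)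

(* Defs.v *)
From HB Require Import structures.
From mathcomp Require Import all_boot generic_quotient all_classical topology.

Set Implicit Arguments.
Unset Strict Implicit.
Unset Printing Implicit Defensive.

Local Open Scope classical_set_scope.
Local Open Scope card_scope.
Local Open Scope quotient_scope.
Local Open Scope group_scope.

HB.mixin Record Group_isTopological T of Group T & Topological T := {
  mulg_continuous : continuous (fun z : T * T => z.1 * z.2) ;
  invg_continuous : continuous (fun x : T => x^-1)
}.

#[short(type="topologicalGroupType")]
HB.structure Definition TopologicalGroup :=
  {T of Group T & Topological T & Group_isTopological T}.

Section AbstractGroups.
Variable T : groupType.

Definition is_subgroup (H : set T) : Prop :=
  [/\ H 1, forall x y, H x -> H y -> H (x * y) & forall x, H x -> H x^-1].

Definition normalised_by (N H : set T) : Prop :=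
  forall x g, N x -> H g -> N (x ^ g).

Record subgroup := Subgroup {
  subgroup_set :> set T ;
  subgroupP : is_subgroup subgroup_set
}.

Record normal_subgroup := NormalSubgroup {
  normal_subgroup_sub :> subgroup ;
  normal_subgroupP : normalised_by normal_subgroup_sub setT
}.

Definition conj_set (H : set T) (g : T) : set T := [set h ^ g | h in H].

Definition core (H : set T) : set T := \bigcap_(g in [set: T]) conj_set H g.

Definition maximal_subgroup (H : subgroup) : Prop :=
  H <> setT :> set T /\
  forall M : subgroup, H `<=` M -> M = H :> set T \/ M = setT :> set T.

Definition primitive : Prop :=
  finite_set [set: T] /\
  exists H : subgroup, maximal_subgroup H /\ core H = [set 1].

Definition center_set : set T := [set z | forall x, commute z x].

Lemma center_is_subgroup : is_subgroup center_set.
Proof.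
split=> [x|x y cx cy z|x cx z]; first exact/commute_sym/commute1.
  exact/commute_sym/commuteM/commute_sym/cy/commute_sym/cx.
exact/commute_sym/commuteV/commute_sym/cx.
Qed.

Definition center_subgroup := Subgroup center_is_subgroup.

Lemma center_normal : normalised_by center_subgroup setT.
Proof.
move=> x g cx _; suff -> : x ^ g = x by [].
by rewrite /conjg (cx g) mulKg.
Qed.

Definition center : normal_subgroup := NormalSubgroup center_normal.

End AbstractGroups.

(* H as a group in its own right; it carries the induced topology below. *)
Definition subgroup_type (T : groupType) (H : subgroup T) : Type := set_type H.

Section SubgroupType.
Variables (T : topologicalGroupType) (H : subgroup T).
Local Notation S := (subgroup_type H).

HB.instance Definition _ := SubChoice.copy S (set_type H).

Lemma subgroup_group_closed : group_closed [in (H : set T)].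
Proof.
have [H1 HM HV] := subgroupP H; split; first exact: mem_set.
by move=> x y /set_mem Hx /set_mem Hy; apply/mem_set/HM => //; apply: HV.
Qed.

HB.instance Definition _ :=
  SubChoice_isSubGroup.Build T [in (H : set T)] S subgroup_group_closed.

HB.instance Definition _ := Topological.copy S (set_type H).

Lemma subgroup_val_continuous : continuous (val : S -> T).
Proof. exact: (@initial_continuous (set_type H) T set_val). Qed.

Lemma continuous_to_subgroup (X : topologicalType) (f : X -> S) :
  continuous (val \o f) -> continuous f.
Proof.
exact: (@continuous_comp_initial (set_type H) X T set_val f).
Qed.

Lemma subgroup_mulg_continuous : continuous (fun z : S * S => z.1 * z.2).
Proof.
apply: continuous_to_subgroup => z.
rewrite (_ : val \o _ = (fun w : T * T => w.1 * w.2) \o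
  (fun z : S * S => (val z.1, val z.2))); last first.
  by apply/funext => -[x y]; rewrite /comp valM.
apply: continuous_comp; last exact: mulg_continuous.
apply: cvg_pair => /=.
  by apply: cvg_comp; [exact: cvg_fst|exact: subgroup_val_continuous].
by apply: cvg_comp; [exact: cvg_snd|exact: subgroup_val_continuous].
Qed.

Lemma subgroup_invg_continuous : continuous (fun x : S => x^-1).
Proof.
apply: continuous_to_subgroup => z.
rewrite (_ : val \o _ = (fun w : T => w^-1) \o (val : S -> T)); last first.
  by apply/funext => x; rewrite /comp gmulfV.
apply: continuous_comp; last exact: invg_continuous.
exact: subgroup_val_continuous.
Qed.

HB.instance Definition _ := Group_isTopological.Build S
  subgroup_mulg_continuous subgroup_invg_continuous.

End SubgroupType.

Section QuotientGroup.
Variables (T : topologicalGroupType) (K : normal_subgroup T).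

Definition eq_coset (x y : T) : bool := `[< (K : set T) (x^-1 * y) >].

Lemma eq_coset_refl : reflexive eq_coset.
Proof. by move=> x; apply/asboolP; rewrite mulVg; case: (subgroupP K). Qed.

Lemma eq_coset_sym : symmetric eq_coset.
Proof.
have [_ _ KV] := subgroupP K.
by move=> x y; apply/asboolP/asboolP => /KV; rewrite invgM invgK.
Qed.

Lemma eq_coset_trans : transitive eq_coset.
Proof.
have [_ KM _] := subgroupP K.
move=> y x z /asboolP xy /asboolP yz; apply/asboolP.
by have := KM _ _ xy yz; rewrite mulgA mulgK.
Qed.

Canonical eq_coset_equiv :=
  EquivRel eq_coset eq_coset_refl eq_coset_sym eq_coset_trans.

Definition quotient_group : Type := quotient_topology {eq_quot eq_coset_equiv}.

HB.instance Definition _ := Topological.on quotient_group.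
HB.instance Definition _ := Quotient.on quotient_group.

Local Notation Q := quotient_group.

Definition coset_map (x : T) : Q := \pi_Q%qT x.

Lemma coset_mapP x y : coset_map x = coset_map y <-> (K : set T) (x^-1 * y).
Proof.
split=> [/(@eqquotP _ eq_coset_equiv {eq_quot eq_coset_equiv})/asboolP //|Kxy].
by apply/(@eqquotP _ eq_coset_equiv {eq_quot eq_coset_equiv})/asboolP.
Qed.

Lemma coset_map_repr (a : Q) : coset_map (repr a) = a.
Proof. exact: reprK. Qed.

Definition quotient_mul (a b : Q) : Q := coset_map (repr a * repr b).
Definition quotient_inv (a : Q) : Q := coset_map (repr a)^-1.

Lemma coset_mapM x y :
  coset_map (x * y) = quotient_mul (coset_map x) (coset_map y).
Proof.
have [_ KM _] := subgroupP K; have KJ := @normal_subgroupP _ K.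
apply/coset_mapP; set x' := repr _; set y' := repr _.
have /coset_mapP Kx : coset_map x = coset_map x' by rewrite coset_map_repr.
have /coset_mapP Ky : coset_map y = coset_map y' by rewrite coset_map_repr.
have -> : (x * y)^-1 * (x' * y') = (x^-1 * x') ^ y * (y^-1 * y').
  by rewrite /conjg invgM !mulgA mulgK.
by apply: KM => //; exact: KJ.
Qed.

Lemma coset_mapV x : coset_map x^-1 = quotient_inv (coset_map x).
Proof.
have [_ _ KV] := subgroupP K; have KJ := @normal_subgroupP _ K.
apply/coset_mapP; set x' := repr _.
have /coset_mapP Kx : coset_map x = coset_map x' by rewrite coset_map_repr.
have -> : x^-1^-1 * x'^-1 = ((x^-1 * x')^-1) ^ x^-1.
  by rewrite /conjg invgM !invgK !mulgA mulgK.
by apply: KJ => //; exact: KV.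
Qed.

Lemma quotient_mulA : associative quotient_mul.
Proof.
move=> a b c; rewrite -[a]coset_map_repr -[b]coset_map_repr -[c]coset_map_repr.
by rewrite -!coset_mapM mulgA.
Qed.

Lemma quotient_mul1 : left_id (coset_map 1) quotient_mul.
Proof. by move=> a; rewrite -[a]coset_map_repr -!coset_mapM mul1g. Qed.

Lemma quotient_mulr1 : right_id (coset_map 1) quotient_mul.
Proof. by move=> a; rewrite -[a]coset_map_repr -!coset_mapM mulg1. Qed.

Lemma quotient_mulV : left_inverse (coset_map 1) quotient_inv quotient_mul.
Proof.
by move=> a; rewrite -[a]coset_map_repr -coset_mapV -!coset_mapM mulVg.
Qed.

Lemma quotient_mulrV : right_inverse (coset_map 1) quotient_inv quotient_mul.
Proof.
by move=> a; rewrite -[a]coset_map_repr -coset_mapV -!coset_mapM mulgV.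
Qed.

HB.instance Definition _ := isGroup.Build Q quotient_mulA quotient_mul1
  quotient_mulr1 quotient_mulV quotient_mulrV.

Lemma coset_map_continuous : continuous coset_map.
Proof. exact: (@pi_continuous T {eq_quot eq_coset_equiv}). Qed.

Lemma quotient_openE (U : set Q) : open U <-> open (coset_map @^-1` U).
Proof. by []. Qed.

Lemma coset_map_open (U : set T) : open U -> open (coset_map @` U).
Proof.
move=> oU; apply/quotient_openE.
have -> : coset_map @^-1` (coset_map @` U) =
    \bigcup_(k in (K : set T)) ((fun x => x * k) @^-1` U).
  apply/seteqP; split=> [x [u Uu /esym/coset_mapP xu]|x [k Kk Uxk]].
    by exists (x^-1 * u) => //=; rewrite mulVKg.
  by exists (x * k) => //; apply/esym/coset_mapP; rewrite mulKg.
apply: bigcup_open => k _; apply: open_comp => // x _.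
apply: (@continuous_comp _ _ _ (fun x : T => (x, k))
  (fun z : T * T => z.1 * z.2)); last exact: mulg_continuous.
by apply: cvg_pair; [exact: cvg_id|exact: cvg_cst].
Qed.

Lemma quotient_mulg_continuous : continuous (fun z : Q * Q => z.1 * z.2).
Proof.
move=> [a b] U /=; rewrite nbhsE => -[V [oV Vab] VU].
have nV : nbhs (repr a * repr b) (coset_map @^-1` V).
  by apply: coset_map_continuous; apply: open_nbhs_nbhs; split.
have [] := mulg_continuous (repr a, repr b) _ nV.
move=> [A B] [/= nA nB] ABV; move: nA nB.
rewrite (nbhsE (repr a)) (nbhsE (repr b)).
move=> [A' [oA' A'a] A'A] [B' [oB' B'b] B'B].
exists (coset_map @` A', coset_map @` B') => /=; first split.
- apply: open_nbhs_nbhs; split; first exact: coset_map_open.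
  by exists (repr a) => //; rewrite coset_map_repr.
- apply: open_nbhs_nbhs; split; first exact: coset_map_open.
  by exists (repr b) => //; rewrite coset_map_repr.
move=> [_ _] /= [[x A'x <-] [y B'y <-]]; apply: VU.
have /= := ABV (x, y) (conj (A'A _ A'x) (B'B _ B'y)).
by rewrite coset_mapM.
Qed.

Lemma quotient_invg_continuous : continuous (fun a : Q => a^-1).
Proof.
apply/(@quotient_continuous T {eq_quot eq_coset_equiv}).
have -> : (fun a : Q => a^-1) \o \pi_(quotient_topology {eq_quot eq_coset_equiv})%qT
    = coset_map \o (fun x : T => x^-1).
  by apply/funext => x /=; rewrite coset_mapV.
move=> x; apply: continuous_comp; first exact: invg_continuous.
exact: coset_map_continuous.
Qed.

HB.instance Definition _ := Group_isTopological.Build Q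
  quotient_mulg_continuous quotient_invg_continuous.

End QuotientGroup.

Section ProfiniteGroups.
Variable T : topologicalGroupType.

(* Equivalently, an inverse limit of finite discrete groups. *)
Definition profinite : Prop :=
  [/\ compact [set: T], hausdorff_space T & totally_disconnected [set: T]].

Definition closed_subgroup (H : set T) : Prop := closed H /\ is_subgroup H.

(* Topological generation: the least closed subgroup containing A. *)
Definition generated (A : set T) : set T := smallest closed_subgroup A.

Definition perfect : Prop :=
  generated (range (fun z : T * T => [~ z.1, z.2])) = setT.

(* Simplicity in the category of profinite groups: only closed normal subgroups
   are considered. *)
Definition simple : Prop :=
  (exists x : T, x <> 1) /\
  forall N : normal_subgroup T, closed (N : set T) ->
    N = [set 1] :> set T \/ N = setT :> set T.

Definition pro_p (p : nat) : Prop :=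
  profinite /\
  forall N : normal_subgroup T, open (N : set T) ->
    exists n : nat, [set: quotient_group N] #= `I_(p ^ n)%N.

(* A finite series T = c 0 >= c 1 >= ... >= c n = H of closed subgroups, each
   normal in the previous one; the values c i for i > n are irrelevant. *)
Definition subnormal (H : set T) : Prop :=
  exists (n : nat) (c : nat -> set T),
    [/\ c 0%N = setT, c n = H, forall i, (i <= n)%N -> closed_subgroup (c i) &
        forall i, (i < n)%N -> c i.+1 `<=` c i /\ normalised_by (c i.+1) (c i)].

End ProfiniteGroups.

Definition quasisimple (T : topologicalGroupType) : Prop :=
  [/\ profinite T, perfect T & simple (quotient_group (center T))].

Section GeneralisedFitting.
Variable T : topologicalGroupType.

(* O_p(T). *)
Definition pcore (p : nat) : set T :=
  generated (\bigcup_(N in [set N : normal_subgroup T |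
    closed (N : set T) /\ pro_p (subgroup_type N) p]) N).

Definition Fitting : set T :=
  generated (\bigcup_(p in [set p : nat | prime p]) pcore p).

Definition component (Q : subgroup T) : Prop :=
  [/\ closed (Q : set T), subnormal Q & quasisimple (subgroup_type Q)].

(* E(T). *)
Definition layer : set T := generated (\bigcup_(Q in component) Q).

(* F*(T). *)
Definition generalised_Fitting : set T := generated (Fitting `|` layer).

Definition Fitting_degenerate : Prop := generalised_Fitting = [set 1].

End GeneralisedFitting.

Arguments pcore T p : clear implicits.
Arguments Fitting T : clear implicits.
Arguments layer T : clear implicits.
Arguments generalised_Fitting T : clear implicits.

(* Main.v *)
From HB Require Import structures.
From mathcomp Require Import all_boot all_fingroup all_solvable finmap.
Require Import Defs.
From mathcomp Require Import all_boot generic_quotient all_classical topology.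

Set Implicit Arguments.
Unset Strict Implicit.
Unset Printing Implicit Defensive.

Local Open Scope classical_set_scope.
Local Open Scope card_scope.
Local Open Scope group_scope.

(* A quotient map G -> G/K sends normal pro-p subgroups to normal pro-p
   subgroups and components to components or 1, hence F^*(G) into F^*(G/K);
   this gives one direction.

   Conversely let G be Fitting-degenerate. In a finite group the Frattini
   subgroup is nilpotent, so the intersection of the kernels K of the primitive
   quotients is pronilpotent, and a nontrivial closed normal pronilpotent
   subgroup would contain a nontrivial normal pro-p subgroup; hence that
   intersection is 1. Let R be the set of the x with xK in F^*(G/K) for all
   these K. If no component of any G/K lies in RK/K, then each RK/K is
   nilpotent, so R is pronilpotent, hence trivial. Otherwise a component Q of
   some G/K0 lies in RK0/K0; let L be the centraliser in R of Q modulo K0, so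
   that R/L is the simple group Q/Z(Q). In every G/K the centraliser of LK/K in
   RK/K is not inside LK/K, as R maps into F^*(G/K). Being the kernel of a map
   onto a nonabelian simple group, L behaves like a prime ideal, so compactness
   yields an element of R outside L that centralises L. Since Z(R) = 1, this
   makes C_R(L) a simple direct factor of R, that is, a component of G. *)

(** * Quasisimple and subnormal subgroups of abstract groups *)

Section SubgroupSets.
Variable T : groupType.
Implicit Types (A H N Q R Y : set T) (x y z : T).

Definition commutes_with H N : Prop :=
  forall x y, H x -> N y -> commute x y.

Lemma commutes_withC H N : commutes_with H N -> commutes_with N H.
Proof. by move=> c x y Nx Hy; exact/commute_sym/c. Qed.

Definition centraliser_set A : set T := [set x | forall a, A a -> commute x a].

Lemma centraliser_subgroup A : is_subgroup (centraliser_set A).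
Proof.
split=> [a _|x y cx cy a Aa|x cx a Aa]; first exact/commute_sym/commute1.
  by apply/commute_sym/commuteM; apply/commute_sym; [exact: cx|exact: cy].
exact/commute_sym/commuteV/commute_sym/cx.
Qed.

Lemma commuteJ x y z : commute x y -> commute (x ^ z) (y ^ z).
Proof. by rewrite /commute -!conjMg => ->. Qed.

Lemma centraliser_normalised A R :
  is_subgroup R -> normalised_by A R -> normalised_by (centraliser_set A) R.
Proof.
move=> [_ _ RV] nA x g cx Rg a Aa; rewrite -(conjgKV g a).
by apply/commuteJ/cx/nA => //; exact: RV.
Qed.

Lemma is_subgroupT : is_subgroup [set: T]. Proof. by []. Qed.

Lemma is_subgroup1 : is_subgroup [set 1 : T].
Proof. by split=> // [x y -> ->|x ->] /=; rewrite ?mulg1 ?invg1. Qed.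

Lemma is_subgroupI H N : is_subgroup H -> is_subgroup N ->
  is_subgroup (H `&` N).
Proof.
move=> [H1 HM HV] [N1 NM NV].
by split=> // [x y [? ?] [? ?]|x [? ?]]; split; auto.
Qed.

Lemma is_subgroup_bigcap I (D : set I) (F : I -> set T) :
  (forall i, D i -> is_subgroup (F i)) -> is_subgroup (\bigcap_(i in D) F i).
Proof.
move=> sF; split=> [i /sF[]//|x y Fx Fy i Di|x Fx i Di].
  by have [_ FM _] := sF i Di; apply: (FM); [exact: Fx|exact: Fy].
by have [_ _ FV] := sF i Di; apply: (FV); exact: Fx.
Qed.

Lemma normalised_byI H N R : normalised_by H R -> normalised_by N R ->
  normalised_by (H `&` N) R.
Proof. by move=> nH nN x g [? ?] Rg; split; [exact: nH|exact: nN]. Qed.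

Lemma normalised_by_self H : is_subgroup H -> normalised_by H H.
Proof. by move=> [_ HM HV] x g Hx Hg; apply: (HM); [exact: HV|exact: HM]. Qed.

Lemma subgroupX H x n : is_subgroup H -> H x -> H (x ^+ n).
Proof.
move=> [H1 HM _] Hx; elim: n => [|n IHn]; first by rewrite expg0.
by rewrite expgS; exact: HM.
Qed.

Lemma commMgE x y z : [~ x * y, z] = [~ x, z] ^ y * [~ y, z].
Proof.
by rewrite !commgEr conjMg conjgM (conjVg z y) -(mulgA _ (z ^ y)) mulVKg.
Qed.

Lemma commgME x y z : [~ x, y * z] = [~ x, z] * [~ x, y] ^ z.
Proof. by rewrite -[LHS]invgR commMgE invgM -conjVg !invgR. Qed.

(** Expanding with [commMgE] and [commgME] leaves conjugates of [[~ a, b]] and commutators with an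
    entry in [L]. Hence membership in [L] of a commutator of elements of [R] can be tested on coset
    representatives. *)
Lemma commutatorM_mem L R a l b m : is_subgroup L -> is_subgroup R ->
  L `<=` R -> normalised_by L R ->
  R a -> R b -> L l -> L m -> L [~ a, b] -> L [~ a * l, b * m].
Proof.
move=> [L1 LM LV] [_ RM RV] sLR nLR Ra Rb Ll Lm Lab.
have LR u v : L u -> R v -> L [~ u, v].
  by move=> Lu Rv; rewrite commgEl; apply: (LM); [exact: LV|exact: nLR].
rewrite commMgE commgME.
have Lam : L [~ a, m] by rewrite -invgR; apply: (LV); exact: LR.
apply: (LM); last by apply: (LR) => //; apply: (RM) => //; exact: sLR.
apply: (nLR); last exact: sLR.
by apply: (LM) => //; apply: (nLR) => //; exact: sLR.
Qed.

(** Makes the elements [g] with [[g, R]] inside [L] a subgroup of the whole group. Although [L] is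
    only assumed normal in [R], such [g] conjugate [L] into itself, because [u ^ g = u *
    [~ u, g]]. *)
Lemma commutator_centralised L R g h r : is_subgroup L -> is_subgroup R ->
  L `<=` R -> normalised_by L R -> normalised_by R setT ->
  (forall s, R s -> L [~ g, s]) -> (forall s, R s -> L [~ h, s]) ->
  R r -> L [~ g * h, r] /\ L [~ g^-1, r].
Proof.
move=> sL sR sLR nLR nR Lg Lh Rr; have [_ LM LV] := sL.
have LJ k u : (forall s, R s -> L [~ k, s]) -> L u -> L (u ^ k).
  move=> Lk Lu; rewrite -[u ^ k](mulVKg u) -commgEl; apply: (LM) => //.
  by rewrite -invgR; apply: (LV); apply: Lk; exact: sLR.
split.
  rewrite commMgE.
  by apply: (LM); [apply: (LJ) => //; exact: Lg|exact: Lh].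
have -> : [~ g^-1, r] = [~ g, r ^ g^-1]^-1.
  by rewrite invgR commgEr (commgEl (r ^ _)) conjgKV conjVg.
by apply/LV/Lg/nR.
Qed.

(* [C] is meant to be either the closed sets or all sets; for a subgroup [Q] of
   a profinite group, quasisimplicity is expressed with closed subgroups. *)
Definition quasisimple_set (C : set (set T)) Q : Prop :=
  [/\ is_subgroup Q,
      forall D, C D -> is_subgroup D ->
        (forall x y, Q x -> Q y -> D [~ x, y]) -> Q `<=` D,
      exists x y, [/\ Q x, Q y & ~ commute x y] &
      forall N, C N -> is_subgroup N -> N `<=` Q -> normalised_by N Q ->
        commutes_with N Q \/ Q `<=` N].

(** The algebraic counterpart of [subnormal]: the terms need not be closed, and induction peels off
    the largest term of the series. *)
Inductive subnormal_in H : set T -> Prop :=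
| subnormal_refl : subnormal_in H H
| subnormal_step Y Y1 of is_subgroup Y1 & Y1 `<=` Y & normalised_by Y1 Y
    & subnormal_in H Y1 : subnormal_in H Y.

Lemma subnormal_in_sub H Y : subnormal_in H Y -> H `<=` Y.
Proof. by elim=> // {}Y Y1 _ sY1 _ _; move/subset_trans; exact. Qed.

Lemma subnormal_inI H N Y : is_subgroup N -> subnormal_in H Y -> N `<=` Y ->
  H `<=` N -> subnormal_in H N.
Proof.
move=> sN snH; elim: snH N sN => {Y} [|Y Y1 sY1 Y1Y nY1 snH IH] N sN NY HN.
  have -> : N = H by apply/seteqP; split.
  exact: subnormal_refl.
have HY1 := subnormal_in_sub snH.
apply: (@subnormal_step _ _ (N `&` Y1)) => //; first exact: is_subgroupI.
- apply: normalised_byI; first exact: normalised_by_self.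
  by move=> x g Y1x Ng; apply: (nY1) => //; exact: NY.
- apply: (IH); [exact: is_subgroupI|exact: subIsetr|].
  by move=> x Hx; split; auto.
Qed.

(** The three subgroups lemma with two of the subgroups equal: two of the three factors of the
    Hall-Witt identity vanish by hypothesis, hence so does the third. *)
Lemma three_commuting_subgroups Q N : is_subgroup Q -> is_subgroup N ->
  (forall x y z, Q x -> N y -> Q z -> commute [~ x, y] z) ->
  forall x y z, Q x -> Q y -> N z -> commute [~ x, y] z.
Proof.
move=> [_ _ QV] [_ _ NV] QNQ x y z Qx Qy Nz.
apply/commgP/eqP.
(* Each Hall-Witt factor is a quotient of two values of [a] at cyclically shifted arguments, so the
   product telescopes. *)
pose a x y z : T := x * z * y ^ x.
have aux u v w : [~ u, v^-1, w] ^ v = (a u v w)^-1 * (a v w u).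
  have E : [~ u, v^-1] * v = v ^ u.
    by rewrite commgEl !conjgE invgK !mulgA mulgVK.
  rewrite (commgEr _ w) conjMg -conjgM E (conjgE w^-1) /a (conjgC v u).
  move: (v ^ u) (w ^ v) => k m.
  by rewrite !invgM !mulgA mulgVK.
(* Hall-Witt identity *)
have HW (u v w : T) :
    [~ u, v^-1, w] ^ v * [~ v, w^-1, u] ^ w * [~ w, u^-1, v] ^ u = 1.
  by rewrite !aux; move: a {aux} => a; rewrite 2!mulgA !mulgK mulVg.
have := HW y^-1 z x.
have /commgP/eqP -> : commute [~ y^-1, z^-1] x by apply: (QNQ); auto.
have /commgP/eqP -> : commute [~ z, x^-1] y^-1.
  by rewrite -invgR; apply/commute_sym/commuteV/commute_sym/QNQ; auto.
rewrite invgK !conj1g !mul1g => /eqP; rewrite conjg_eq1 => /eqP //.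
Qed.

Local Notation quasisimple_alg := (quasisimple_set setT).

(** Induction on the series of [Q]. If [Q] centralises the intersection of [N] and [Y1], then
    [[Q, N]], which lies in that intersection, commutes with [Q]. The three subgroups lemma then
    makes [[Q, Q]] centralise [N], and [Q] is perfect. *)
Lemma quasisimple_normal Q N Y : quasisimple_alg Q -> subnormal_in Q Y ->
  is_subgroup N -> N `<=` Y -> normalised_by N Y ->
  Q `<=` N \/ commutes_with Q N.
Proof.
move=> [sQ pQ _ dQ] snQ; elim: snQ N => [N sN NQ nN|].
  by case: (dQ N Logic.I sN NQ nN) => [/commutes_withC|]; [right|left].
move=> {}Y Y1 sY1 Y1Y nY1 snQ IH N sN NY nN.
have QY1 := subnormal_in_sub snQ.
have [| | |QN|cQN] := IH (N `&` Y1).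
- exact: is_subgroupI.
- exact: subIsetr.
- apply: normalised_byI; last exact: normalised_by_self.
  by move=> x g Nx Y1g; apply: (nN) => //; exact: Y1Y.
- by left; apply: subset_trans QN _; exact: subIsetl.
right; have [_ NM NV] := sN; have [_ Y1M Y1V] := sY1.
suff : Q `<=` centraliser_set N by move=> QC x y /QC; exact.
apply: (pQ) => //; first exact: centraliser_subgroup.
move=> x y Qx Qy z Nz.
apply: (three_commuting_subgroups sQ sN) => // u v w Qu Nv Qw.
apply/commute_sym/cQN => //; split.
  rewrite commgEr; apply: (NM) => //; apply: (nN); first exact: NV.
  exact/Y1Y/QY1.
rewrite commgEl; apply: Y1M; first exact/Y1V/QY1.
by apply: (nY1); [exact: QY1|exact: NY].
Qed.

(** Descend the series of [N]: at the term [Y1], either [Q] commutes with [Y1] and so with [N], or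
    [Q] lies in [Y1], is subnormal there, and the descent continues. *)
Lemma quasisimple_subnormal Q N Y : quasisimple_alg Q ->
  subnormal_in Q Y -> subnormal_in N Y -> Q `<=` N \/ commutes_with Q N.
Proof.
move=> qsQ + snN; elim: snN => [/subnormal_in_sub|]; first by left.
move=> {}Y Y1 sY1 Y1Y nY1 snN IH snQ.
case: (quasisimple_normal qsQ snQ sY1 Y1Y nY1) => [QY1|cQ].
  by apply: (IH); apply: subnormal_inI snQ _ QY1.
by right=> x y Qx Ny; apply: cQ => //; exact: subnormal_in_sub snN _ Ny.
Qed.

Definition p_elt_mod (p : nat) N x : Prop := exists n, N (x ^+ (p ^ n)).

Lemma p_elt_modW p N x m n : is_subgroup N -> (m <= n)%N ->
  N (x ^+ (p ^ m)) -> N (x ^+ (p ^ n)).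
Proof.
by move=> sN /subnK <- Nx; rewrite addnC expnD expgnA; exact: subgroupX.
Qed.

Definition normal_p (p : nat) N : Prop :=
  [/\ is_subgroup N, normalised_by N setT &
      forall x, N x -> p_elt_mod p [set 1] x].

(* For finite groups this is the generalised Fitting subgroup, stripped of its
   topology. *)
Definition Fitting_hull : set T := [set x | forall D, is_subgroup D ->
  (forall p N, prime p -> normal_p p N -> N `<=` D) ->
  (forall Q, quasisimple_alg Q -> subnormal_in Q setT -> Q `<=` D) -> D x].

Lemma Fitting_hull_min D : is_subgroup D ->
  (forall p N, prime p -> normal_p p N -> N `<=` D) ->
  (forall Q, quasisimple_alg Q -> subnormal_in Q setT -> Q `<=` D) ->
  Fitting_hull `<=` D.
Proof. by move=> sD ND QD x; apply. Qed.

End SubgroupSets.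
Notation quasisimple_alg := (quasisimple_set setT).

(** * Finite groups *)

(* An equality of structures lets a statement about [X] be transported to a
   [finGroupType] with the same carrier and operations. *)
Lemma finite_groupP (X : groupType) : finite_set [set: X] ->
  exists Y : finGroupType, (Y : groupType) = X.
Proof.
destruct X as [X []]; move=> /finite_fsetP [s sE].
set G := Group.Pack _ in s sE *.
have sP (x : G) : x \in s by have : [set: X] x by []; rewrite sE.
pose f (x : G) : fset_sub_type s := FSetSub (sP x).
have fK : cancel f val by [].
have enumP : Finite.axiom (enum_fset s).
  by move=> x; rewrite count_uniq_mem ?fset_uniq // sP.
pose F : finGroupType := HB.pack (Group.sort G)
  (@CanIsCountable (s : finType) G f val fK)
  (isFinite.Build G enumP).
by exists F.
Qed.

Lemma subgroup_to_group (Y : finGroupType) (H : set Y) : is_subgroup H ->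
  exists A : {group Y}, forall x, x \in A <-> H x.
Proof.
move=> [H1 HM _].
have gA : group_set [set x in H]%SET.
  by apply/group_setP; rewrite !inE; split=> // x y; rewrite !inE; exact: HM.
by exists (fingroup.Group gA) => x; rewrite !inE.
Qed.

Lemma group_to_subgroup (Y : finGroupType) (A : {group Y}) :
  is_subgroup [set x | x \in A].
Proof.
by split=> [|x y|x] /=; [exact: group1|exact: groupM|rewrite groupV].
Qed.

Lemma normal_p_pgroup (Y : finGroupType) p (N : set Y) (A : {group Y}) :
  (forall x, x \in A <-> N x) -> prime p -> normal_p p N ->
  p.-group A /\ A <| [set: Y]%G%SET.
Proof.
move=> AN p_pr [_ nN pN]; split.
  apply/pgroupP => q q_pr qA; have [x xA xq] := Cauchy q_pr qA.
  have /pN[n /= xn] : N x by apply/AN.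
  have : #[x] %| p ^ n by rewrite order_dvdn xn.
  rewrite xq -pnatE // => /pnat_dvd; apply.
  by rewrite pnatX pnat_id.
rewrite /normal finset.subsetT; apply/fintype.subsetP => g _; rewrite inE.
apply/fintype.subsetP => _ /imsetP[x /AN Nx ->]; exact/AN/nN.
Qed.

(** A finite [p]-group is soluble, so each nontrivial subgroup properly contains its derived group,
    against the perfection of [Q]. *)
Lemma quasisimple_not_p (X : groupType) p (N Q : set X) :
  finite_set [set: X] -> prime p -> normal_p p N -> quasisimple_alg Q ->
  ~ Q `<=` N.
Proof.
move=> /finite_groupP[Y YX]; case: _ / YX in N Q *.
move=> p_pr pN [sQ pQ [x [y [Qx Qy nc]]] _] QN; apply: nc.
have [sN _ _] := pN.
have [A AN] := subgroup_to_group sN; have [B BQ] := subgroup_to_group sQ.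
have [/pgroup_sol solA _] := normal_p_pgroup AN p_pr pN.
have sBA : B \subset A by apply/fintype.subsetP => z /BQ/QN/AN.
have [B1|ntB] := eqVneq (B : {set Y}) 1.
  move/BQ : Qx; move/BQ : Qy; rewrite B1 => /set1P -> /set1P ->.
  exact: commute_refl.
have := sol_der1_proper solA sBA ntB; rewrite properE => /andP[_ /fintype.subsetP[]].
move=> z /BQ; apply: (pQ [set z | z \in B^`(1)]) => //.
  exact: group_to_subgroup.
by move=> u v /BQ Bu /BQ Bv; exact: mem_commg.
Qed.

(** The [p]-elements of a nilpotent group are exactly the elements of its normal Sylow subgroup
    ['O_p(A)]. *)
Lemma nilpotent_p_closed (Y : finGroupType) (A : {group Y}) p x y :
  nilpotent A -> prime p -> x \in A -> y \in A ->
  p_elt_mod p [set 1] x -> p_elt_mod p [set 1] y ->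
  p_elt_mod p [set 1] (x * y).
Proof.
move=> nilA p_pr xA yA.
have pE z : z \in A -> p_elt_mod p [set 1] z <-> z \in 'O_p(A).
  move=> zA; rewrite (mem_Hall_pcore (nilpotent_pcore_Hall p nilA)) //.
  split=> [[n /eqP]|].
    rewrite -order_dvdn /p_elt => /pnat_dvd; apply.
    by rewrite pnatX pnat_id.
  by move=> /p_natP[n zn]; exists n; rewrite /= -zn expg_order.
by move=> /pE-/(_ xA) px /pE-/(_ yA) py; apply/pE; rewrite groupM.
Qed.

(** For a Sylow subgroup [P] of ['Phi(A)], the Frattini argument writes [A] as the product of
    ['Phi(A)] and ['N_A(P)]. Elements of ['Phi(A)] are nongenerators, so [P] is normal in [A]; and
    the Sylow subgroups generate ['Phi(A)]. *)
Lemma Phi_nilpotent (Y : finGroupType) (A : {group Y}) : nilpotent 'Phi(A).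
Proof.
apply: nilpotentS (Fitting_nil 'Phi(A)).
suff : <<\bigcup_(P : {group Y} | Sylow 'Phi(A) P) P>> \subset 'F('Phi(A)).
  by rewrite Sylow_gen.
rewrite gen_subG;
 apply/bigcupsP => P /SylowP[p _ sylP].
apply: Fitting_max; last exact: pgroup_nil (pHall_pgroup sylP).
have defA := Frattini_arg (Phi_normal A) sylP.
have nPA : 'N_A(P) = A.
  rewrite -[LHS]genGid; apply: Phi_nongen.
  rewrite norm_joinEr ?defA // (fintype.subset_trans (finset.subsetIl _ _)) //.
  by rewrite normal_norm ?Phi_normal.
rewrite /normal (pHall_sub sylP) (fintype.subset_trans (Phi_sub A)) //.
by move: (finset.subsetIr A 'N(P)); rewrite nPA.
Qed.

(** Normal [p]-subgroups lie in the Fitting subgroup [F] and components centralise [R], so [R] lies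
    in [F C(R)]. Thus [R/Z(R)] embeds in [F C(R)/C(R)], a quotient of [F], and [R] is nilpotent. *)
Lemma p_closed_hull (X : groupType) (R : set X) p x y :
  finite_set [set: X] -> is_subgroup R -> normalised_by R setT ->
  R `<=` @Fitting_hull X ->
  (forall Q, quasisimple_alg Q -> subnormal_in Q setT -> commutes_with Q R) ->
  prime p -> R x -> R y ->
  p_elt_mod p [set 1] x -> p_elt_mod p [set 1] y ->
  p_elt_mod p [set 1] (x * y).
Proof.
move=> finX sR nR hullR cR p_pr.
have [Y YX] := finite_groupP finX; case: _ / YX in R sR nR hullR x y cR {finX} *.
have [A AR] := subgroup_to_group sR.
have nA : [set: Y]%SET \subset 'N(A).
  apply/fintype.subsetP => g _; rewrite inE.
  apply/fintype.subsetP => _ /imsetP[z /AR Rz ->].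
  exact/AR/nR.
pose F := 'F([set: Y]%G)%SET.
move=> /AR Ax /AR Ay; apply: (nilpotent_p_closed _ p_pr Ax Ay).
have sAFC : A \subset F <*> 'C(A).
  apply/fintype.subsetP => z /AR/hullR.
  apply: (@Fitting_hull_min _ [set z | z \in F <*> 'C(A)]) =>
    [|q N q_pr qN z' Nz'|Q qsQ snQ z' Qz']; first exact: group_to_subgroup.
    have [sN _ _] := qN; have [B BN] := subgroup_to_group sN.
    have [/pgroup_nil nilB nsB] := normal_p_pgroup BN q_pr qN.
    apply: (fintype.subsetP (joing_subl _ _)).
    by apply: (fintype.subsetP (Fitting_max nsB nilB)); exact/BN.
  apply: (fintype.subsetP (joing_subr _ _)); apply/centP => a /AR Ra.
  exact: cR qsQ snQ _ _ Qz' Ra.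
have nCA : A \subset 'N('C(A)).
  by apply: norms_cent; apply: fintype.subset_trans nA; exact: finset.subsetT.
rewrite -quotient_center_nil /center.center finset.setIC (isog_nil (second_isog nCA)).
apply: nilpotentS (quotientS _ sAFC) _.
rewrite quotientYidr ?quotient_nil ?Fitting_nil //.
by apply: norms_cent; exact: fintype.subset_trans nA.
Qed.

(** The hypotheses say that [R/L] is nonabelian and simple. Climb the derived series of the soluble
    group [N] from its trivial term: a term whose trace on [R] is not inside [L] covers [R/L], and
    then all commutators of [R] lie in [L], because the trace of the next term does. *)
Lemma normal_p_sub_kernel (X : groupType) (R L N : set X) p :
  finite_set [set: X] -> is_subgroup R -> normalised_by R setT ->
  is_subgroup L -> L `<=` R ->
  normalised_by L R -> (exists r s, [/\ R r, R s & ~ L [~ r, s]]) ->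
  (forall A, is_subgroup A -> A `<=` R -> normalised_by A R ->
     A `<=` L \/ forall r, R r -> exists a l, [/\ A a, L l & r = a * l]) ->
  prime p -> normal_p p N -> N `&` R `<=` L.
Proof.
move=> finX sR nR sL sLR nLR nab dich p_pr pN.
have [Y YX] := finite_groupP finX.
case: _ / YX in R sR nR L N sL sLR nLR nab dich pN {finX} *.
have [sN _ _] := pN; have [A AN] := subgroup_to_group sN.
have [/pgroup_sol/derivedP[n An1] nsA] := normal_p_pgroup AN p_pr pN.
have [L1 _ _] := sL.
have step j : [set x | x \in A^`(j.+1)] `&` R `<=` L ->
    [set x | x \in A^`(j)] `&` R `<=` L.
  move=> subL; have nAj : [set: Y]%SET \subset 'N(A^`(j)).
    exact: normal_norm (char_normal_trans (der_char j A) nsA).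
  have := dich ([set x | x \in A^`(j)] `&` R) _ _ _; case=> //.
  - exact/is_subgroupI/sR/group_to_subgroup.
  - move=> x g [/= Ajx Rx] Rg; split; last by apply: nR.
    by rewrite /= memJ_norm // (fintype.subsetP nAj) // finset.in_setT.
  move=> RAL; have [r [s [/RAL[a [l [[Aja Ra] Ll ->]]]]]] := nab.
  move=> /RAL[b [m [[Ajb Rb] Lm ->]]]; case.
  apply: (commutatorM_mem sL sR) => //; apply: subL; split.
    by rewrite /= dergSn mem_commg.
  by have [_ RM RV] := sR; rewrite commgEl; apply: (RM); [exact: RV|exact: nR].
have sub k i : (i + k)%N = n -> [set x | x \in A^`(i)] `&` R `<=` L.
  elim: k i => [|k IHk] i ik; last by apply/step/IHk; rewrite addSnnS.
  by move=> x [/=]; rewrite -(addn0 i) ik An1 => /set1P ->.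
by move=> x [/AN Ax Rx]; exact: (sub n 0%N).
Qed.

(** * Normal subgroups inside the generalised Fitting subgroup of a finite group *)

Section FiniteFittingHull.
Variable X : groupType.
Hypothesis finX : finite_set [set: X].
Variable R : set X.
Hypotheses (sR : is_subgroup R) (nR : normalised_by R setT).
Hypothesis hullR : R `<=` @Fitting_hull X.

(** If [R] contains a component [Q], every generator of the hull lies in [Q] or centralises it,
    normal [p]-subgroups being too small to contain [Q]. If not, all components centralise [R] and
    [p_closed_hull] applies. *)
Lemma component_or_p_closed :
  (exists Q, [/\ quasisimple_alg Q, subnormal_in Q R &
     forall r, R r -> exists q c, [/\ Q q, centraliser_set Q c & r = q * c]]) \/
  (forall p x y, prime p -> R x -> R y ->
     p_elt_mod p [set 1] x -> p_elt_mod p [set 1] y ->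
     p_elt_mod p [set 1] (x * y)).
Proof.
have [[Q [qsQ snQ QR]]|noQ] := pselect (exists Q : set X,
    [/\ quasisimple_alg Q, subnormal_in Q setT & Q `<=` R]).
  left; exists Q; split=> //; first exact: subnormal_inI snQ _ _.
  pose D := [set r | exists q c, [/\ Q q, centraliser_set Q c & r = q * c]].
  have [sQ _ _ _] := qsQ; have [Q1 QM QV] := sQ.
  have [C1 CM CV] := centraliser_subgroup Q.
  have QD : Q `<=` D by move=> q Qq; exists q, 1; rewrite mulg1.
  have CD : centraliser_set Q `<=` D by move=> c Cc; exists 1, c; rewrite mul1g.
  move=> r /hullR; apply: (@Fitting_hull_min _ D); first split.
  - exact: QD.
  - move=> _ _ [q [c [Qq Cc ->]]] [q' [c' [Qq' Cc' ->]]].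
    exists (q * q'), (c * c'); split; [exact: QM|exact: CM|].
    by rewrite !mulgA -[in LHS](mulgA q) (Cc _ Qq') mulgA.
  - move=> _ [q [c [Qq Cc ->]]]; exists q^-1, c^-1; split.
    + exact: QV.
    + exact: CV.
    + by rewrite -invgM (Cc _ Qq).
  - move=> p N p_pr pN; have [sN nN _] := pN.
    case: (quasisimple_normal qsQ snQ sN _ nN) => // [QN|cQN].
      by case: (quasisimple_not_p finX p_pr pN qsQ).
    by apply: subset_trans CD => x Nx q Qq; exact/commute_sym/cQN.
  - move=> Q' qsQ' snQ'.
    case: (quasisimple_subnormal qsQ' snQ' snQ) => [Q'Q|cQ'].
      exact: subset_trans QD.
    by apply: subset_trans CD => x Q'x q Qq; exact: cQ'.
right; have cR Q : quasisimple_alg Q -> subnormal_in Q setT -> commutes_with Q R.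
  move=> qsQ snQ; case: (quasisimple_normal qsQ snQ sR _ nR) => // QR.
  by case: noQ; exists Q.
by move=> p x y p_pr; exact: p_closed_hull.
Qed.

(** Suppose the centraliser of [L] in [R] lay in [L]. Then the [r] with [[r, R]] inside [L] would
    form a subgroup containing all normal [p]-subgroups and all components, where a component inside
    [R] lies in [L] or centralises it. That subgroup would contain [R], making [R/L] abelian. *)
Lemma centraliser_not_sub L : is_subgroup L -> L `<=` R ->
  normalised_by L R -> (exists r s, [/\ R r, R s & ~ L [~ r, s]]) ->
  (forall A, is_subgroup A -> A `<=` R -> normalised_by A R ->
     A `<=` L \/ forall r, R r -> exists a l, [/\ A a, L l & r = a * l]) ->
  exists y, [/\ R y, ~ L y & centraliser_set L y].
Proof.
move=> sL sLR nLR nab dich; apply: contrapT => noy.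
have CL y : R y -> centraliser_set L y -> L y.
  by move=> Ry cy; apply: contrapT => nLy; apply: noy; exists y.
have [r [s [Rr Rs]]] := nab; apply; move: r Rr s Rs.
suff RD r : R r -> forall s, R s -> L [~ r, s] by [].
have [R1 RM RV] := sR; have [L1 LM LV] := sL.
have comm1 x y : commute x y -> L [~ x, y] by move/commgP/eqP => ->.
move=> /hullR; apply: (@Fitting_hull_min _
  [set r | forall s, R s -> L [~ r, s]]) =>
  [|p N p_pr pN x Nx s Rs|Q qsQ snQ x Qx s Rs].
- split=> [s _|x y Dx Dy s Rs|x Dx s Rs]; first exact/comm1/commute_sym/commute1.
    by have [] := commutator_centralised sL sR sLR nLR nR Dx Dy Rs.
  by have [] := commutator_centralised sL sR sLR nLR nR Dx Dx Rs.
- have [sN nN _] := pN; have [_ NM NV] := sN.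
  apply: (normal_p_sub_kernel finX sR nR sL sLR nLR nab dich p_pr pN); split.
    by rewrite commgEl; apply: (NM); [exact: NV|exact: nN].
  by rewrite commgEr; apply: (RM) => //; apply: nR => //; exact: RV.
- case: (quasisimple_normal qsQ snQ sR _ nR) => // [QR|cQR]; last first.
    exact/comm1/cQR.
  have snQR : subnormal_in Q R by apply: subnormal_inI snQ _ QR.
  have Lx : L x.
    case: (quasisimple_normal qsQ snQR sL sLR nLR) => [QL|cQL]; first exact: QL.
    by apply: CL => [|l Ll]; [exact: QR|exact: cQL].
  by rewrite commgEl; apply: (LM); [exact: LV|exact: nLR].
Qed.

End FiniteFittingHull.

(** [P] lies in the Frattini subgroup, which is nilpotent. *)
Lemma p_closed_Frattini (X : groupType) (P : set X) p x y :
  finite_set [set: X] ->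
  (forall M : subgroup X, maximal_subgroup M -> P `<=` M) ->
  prime p -> P x -> P y ->
  p_elt_mod p [set 1] x -> p_elt_mod p [set 1] y ->
  p_elt_mod p [set 1] (x * y).
Proof.
move=> finX maxP p_pr; have [Y YX] := finite_groupP finX.
case: _ / YX in P maxP x y {finX} *.
have inPhi z : P z -> z \in 'Phi([set: Y]%G)%SET.
  move=> Pz; apply/bigcapP => H; rewrite /maximal_eq => /predU1P[->|maxH].
    exact: finset.in_setT.
  pose M := Subgroup (group_to_subgroup H).
  suff /maxP/(_ _ Pz) : maximal_subgroup M by [].
  have [/properP[_ [z0 _ nHz0]] maxH'] := maxgroupP maxH; split.
    move=> HT; case/negP: nHz0; suff : (M : set Y) z0 by []; by rewrite HT.
  move=> M' sHM'; have [B BM'] := subgroup_to_group (subgroupP M').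
  have sHB : H \subset B by apply/fintype.subsetP => u Hu; apply/BM'/sHM'.
  have [BT|nBT] := eqVneq (B : {set Y}) [set: Y]%SET.
    right; apply/seteqP; split=> // u _; apply/BM'.
    by rewrite BT finset.in_setT.
  left; have BH : B = H :> {set Y}.
    by apply: maxH' => //; rewrite finset.properEneq nBT finset.subsetT.
  by apply/seteqP; split=> u /=; rewrite -BH => /BM'.
move=> /inPhi Px /inPhi Py.
exact: (nilpotent_p_closed (Phi_nilpotent _) p_pr Px Py).
Qed.

(** * Profinite topology *)

(** The sets [f i] form a filter base, and a cluster point of it lies in each of them by
    closedness. *)
Lemma compact_directed (T : topologicalType) I (D : set I) (f : I -> set T) :
  compact [set: T] -> D !=set0 ->
  (forall i, D i -> closed (f i) /\ f i !=set0) ->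
  (forall i j, D i -> D j -> exists2 k, D k & f k `<=` f i `&` f j) ->
  exists x, forall i, D i -> f i x.
Proof.
move=> cT D0 fD dirD.
have FF : Filter (filter_from D f) by apply: filter_from_filter.
have PF : ProperFilter (filter_from D f).
  by apply: filter_from_proper => i /fD[].
have [|x [_ clx]] := cT (filter_from D f) PF.
  by have [i Di] := D0; exists i.
exists x => i Di; have [cf _] := fD i Di; apply: (cf) => B nB.
by apply: clx => //; exists i.
Qed.

(** The intersection of all clopen sets around [x] is connected, hence equals [[set x]]; by
    compactness a single clopen set then already fits into [U]. *)
Lemma compact_clopen_nbhs (T : topologicalType) (x : T) (U : set T) :
  compact [set: T] -> hausdorff_space T -> totally_disconnected [set: T] ->
  nbhs x U -> exists C, [/\ clopen C, C x & C `<=` U].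
Proof.
move=> cT hT dT; rewrite nbhsE => -[W [oW Wx] WU].
pose F := [set C : set T | clopen C /\ C x].
have FT : F setT by split=> //; exact: clopenT.
have FI A B : F A -> F B -> F (A `&` B).
  by move=> [cA Ax] [cB Bx]; split; [exact: clopenI|split].
have shrink (V : set T) : open V -> (\bigcap_(C in F) C) `<=` V ->
    exists2 C, F C & C `<=` V.
  move=> oV QV; apply: contrapT => noC.
  have [|||y Fy] := @compact_directed T _ F (fun C => C `&` ~` V) cT.
  - by exists setT.
  - move=> C FC; split.
      by apply: closedI; [case: FC => -[]|exact: open_closedC].
    by apply: contrapT => CV; apply: noC; exists C => // y Cy;
      apply: contrapT => nVy; apply: CV; exists y.
  - move=> A B FA FB; exists (A `&` B); first exact: FI.
    by move=> y [[Ay By] nVy].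
  by have [_] := Fy _ FT; apply; apply: QV => C /Fy[].
suff QE : \bigcap_(C in F) C `<=` [set x].
  have [|C [cC Cx] CW] := shrink _ oW; first by move=> y /QE ->.
  by exists C; split=> //; exact: subset_trans WU.
have clQ : closed (\bigcap_(C in F) C) by apply: closed_bigI => C [[]].
rewrite -(dT x I); apply: connected_component_max => //.
  by move=> C [].
apply/connectedP => E [E0 QE [sE1 sE2]].
have sep b : closure (E b) `&` E (~~ b) = set0 by case: b => //=; rewrite setIC.
have EQ b : E b `<=` \bigcap_(C in F) C.
  by rewrite QE; case: b; [exact: subsetUr|exact: subsetUl].
have clE b : closed (E b).
  move=> y cly; have : (\bigcap_(C in F) C) y.
    by apply: clQ; exact: closure_subset (EQ b) _ cly.
  have : ~ E (~~ b) y by move=> nEy; rewrite -[False]/(set0 y) -(sep b).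
  by rewrite QE => nEy []; case: b cly nEy {sep}.
have [b Ebx] : exists b, E b x.
  have : (\bigcap_(C in F) C) x by move=> C [].
  by rewrite QE => -[]; [exists false|exists true].
(* Normality separates the two closed pieces [E b] and [E (~~ b)] of a supposed separation, where
   [E b] is the piece containing [x]. *)
have [N nN cN] : filter_from (set_nbhs (E b)) closure (~` E (~~ b)).
  apply: compact_normal => //; apply/set_nbhsP; exists (~` E (~~ b)); split=> //.
    exact: closed_openC.
  move=> y Ey nEy; rewrite -[False]/(set0 y) -(sep b).
  by split=> //; exact: subset_closure.
have /set_nbhsP[V [oV EV VN]] := nN.
have [||C [[oC cC] Cx] CVW] := shrink (V `|` ~` closure N).
- by apply: openU => //; exact/closed_openC/closed_closure.
- rewrite QE => y Qy; have : E b y \/ E (~~ b) y.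
    by case: b Qy {EV cN sep nN Ebx} => -[]; by [left|right].
  by case=> [/EV|Ey]; [left|right=> /cN].
(* [C] avoids the part of [closure N] outside [V], so its traces on the open [V] and on the closed
   [closure N] coincide. This clopen set around [x] must contain both pieces, yet it misses
   [E (~~ b)]. *)
have FCV : F (C `&` V).
  split; last by split=> //; exact: EV.
  split; first exact: openI.
  suff -> : C `&` V = C `&` closure N.
    by apply: closedI => //; exact: closed_closure.
  apply/seteqP; split=> y [Cy]; first by move=> /VN /subset_closure.
  by move=> Ny; split=> //; case: (CVW y Cy).
have [y Ey] := E0 (~~ b); have [_ /VN Ny] : (C `&` V) y by apply: (EQ _ _ Ey).
exact: (cN y (@subset_closure _ _ _ Ny)).
Qed.

Section Generated.
Variable G : topologicalGroupType.
Implicit Types A D : set G.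

Lemma generated_min A D : closed D -> is_subgroup D -> A `<=` D ->
  generated A `<=` D.
Proof. by move=> cD sD AD; exact: smallest_sub. Qed.

Lemma sub_generated A : A `<=` generated A.
Proof. exact: sub_gen_smallest. Qed.

Lemma generated_subgroup A : is_subgroup (generated A).
Proof. by apply: is_subgroup_bigcap => D [[]]. Qed.

End Generated.

Section ProfiniteTopology.
Variable G : topologicalGroupType.
Hypothesis profG : profinite G.

Lemma mulg_near (a b : G) (U : set G) : nbhs (a * b) U ->
  exists A B, [/\ nbhs a A, nbhs b B & forall x y, A x -> B y -> U (x * y)].
Proof.
move=> /(mulg_continuous (a, b))[[A B] [/= nA nB] ABU].
by exists A, B; split=> // x y Ax By; exact: (ABU (x, y)).
Qed.

Lemma mulgl_continuous (a : G) : continuous (fun x : G => a * x).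
Proof.
move=> x U /mulg_near[A [B [/nbhs_singleton Aa nB AB]]].
by apply: filterS nB => y; exact: AB.
Qed.

Lemma conj_continuous : continuous (fun z : G * G => z.1 ^ z.2).
Proof.
move=> [x y] U /= /mulg_near[A [B [/invg_continuous nA]]].
move=> /mulg_near[A' [B' [nA' nB' AB']]] AB.
exists (A', (fun y => A y^-1) `&` B'); first by split=> //; exact: filterI.
by move=> [u v] /= [A'u [Av B'v]]; apply: AB => //; exact: AB'.
Qed.

Lemma centraliser_closed (A : set G) : hausdorff_space G ->
  closed (centraliser_set A).
Proof.
move=> hG.
have -> : centraliser_set A = \bigcap_(a in A) ((fun z => a ^ z) @^-1` [set a]).
  apply/seteqP; split=> z cz a Aa.
    by apply/conjg_fixP/commgP/commute_sym; exact: cz.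
  by apply/commute_sym/commgP/conjg_fixP; exact: cz.
apply: closed_bigI => a _; apply: closed_comp; last first.
  exact: accessible_closed_set1 (hausdorff_accessible hG) a.
move=> z _ U /(@conj_continuous (a, z))[[P Q] [/= nP nQ] PQU].
apply: filterS nQ => y Qy; apply: (PQU (a, y)); split=> //.
exact: nbhs_singleton.
Qed.

Lemma open_subgroup (N V : set G) : is_subgroup N -> nbhs 1 V -> V `<=` N ->
  open N.
Proof.
move=> [_ NM _] nV VN; rewrite openE => x Nx.
have : nbhs x (fun y => V (x^-1 * y)).
  by apply: (@mulgl_continuous x^-1 x V); rewrite mulVg.
by apply: filterS => y /VN Ny; rewrite -(mulVKg x y); exact: NM.
Qed.

Lemma open_normal_nbhs (U : set G) : nbhs 1 U ->
  exists N : normal_subgroup G, open (N : set G) /\ N `<=` U.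
Proof.
have [cG hG dG] := profG => /(compact_clopen_nbhs cG hG dG)[C [[oC cC] C1 CU]].
(* The elements all of whose conjugates stabilise [C] on the right. *)
pose M := [set g : G | forall a c, C c <-> C (c * g ^ a)].
have sM : is_subgroup M.
  split=> [a c|x y Mx My a c|x Mx a c]; first by rewrite conj1g mulg1.
    by rewrite conjMg mulgA (Mx a); exact: My.
  by rewrite (Mx a (c * _)) -mulgA -conjMg mulVg conj1g mulg1.
have nM : normalised_by M setT by move=> x g Mx _ a c; rewrite -conjgM.
pose N := @NormalSubgroup _ (Subgroup sM) nM.
exists N; split; last first.
  by move=> x Mx; apply: CU; have [/(_ C1)] := Mx 1 1; rewrite mul1g conjg1.
(* A tube argument: each pair [(a, c)] has a neighbourhood that works together with some
   neighbourhood of 1, and compactness of the square of [G] gives one neighbourhood of 1 for all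
   pairs. The set [D] in [cover] stands for [C] and for its complement. *)
have [V nV VM] : exists2 V, nbhs (1 : G) V & V `<=` M.
  have cGG : compact ([set: G] `*` [set: G]) by exact: compact_setX.
  have cover D (z : G * G) : open D -> D z.2 ->
      \forall z' \near z & g \near (1 : G), D z'.2 /\ D (z'.2 * g ^ z'.1).
    move=> oD Dz; have nD : nbhs z.2 D by exact: open_nbhs_nbhs.
    have [A [B [nA nB ABD]]] : exists A B, [/\ nbhs z.2 A, nbhs (1 : G) B &
        forall x y, A x -> B y -> D (x * y)] by apply: mulg_near; rewrite mulg1.
    have [[P Q] [/= nP nQ] PQB] :
        nbhs ((1, z.1) : G * G) (fun u => B (u.1 ^ u.2)).
      by apply: (@conj_continuous (1, z.1) B); rewrite /= conj1g.
    exists (Q `*` (A `&` D), P); first split=> //=.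
      by exists (Q, A `&` D) => //; split=> //; exact: filterI.
    move=> [[a c] g] [/= [Qa [Ac Dc]] Pg]; split=> //.
    by apply: ABD => //; exact: (PQB (g, a)).
  have /compact_near_coveringP/(_ _ (nbhs (1 : G)) _ _) := cGG.
  move=> /(_ (fun g z => C z.2 <-> C (z.2 * g ^ z.1)) _) nc.
  exists [set g | forall z : G * G, C z.2 <-> C (z.2 * g ^ z.1)].
    apply: filterS (nc _) => //.
      by move=> g /= Pg z; apply: Pg.
    move=> z _; have [Cz|nCz] := pselect (C z.2).
      by apply: filterS (cover _ z oC Cz) => u [].
    by apply: filterS (cover _ z (closed_openC cC) nCz) => u [].
  by move=> g Pg a c; exact: (Pg (a, c)).
exact: open_subgroup VM.
Qed.

End ProfiniteTopology.

Lemma card_finType (Y : finType) : [set: Y] #= `I_#|Y|.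
Proof.
have -> : [set: Y] = enum_val @` [set: 'I_#|Y|].
  by apply/seteqP; split=> // y _; exists (enum_rank y) => //; rewrite enum_rankK.
apply: card_eq_trans; last by rewrite card_eq_sym; exact: card_II.
by apply: inj_card_eq => i j _ _; exact: enum_val_inj.
Qed.

Lemma expg_card_set (X : groupType) m (x : X) :
  [set: X] #= `I_m -> x ^+ m = 1.
Proof.
move=> Xm; have finX : finite_set [set: X] by apply/finite_setP; exists m.
have [Y YX] := finite_groupP finX; case: _ / YX in x Xm {finX} *.
have <- : #|Y| = m.
  by apply/card_eq_II; apply: card_eq_trans Xm; rewrite card_eq_sym card_finType.
by rewrite -cardsT; apply: (@expg_cardG _ [set: Y]%G); rewrite finset.in_setT.
Qed.

Lemma card_p_group (X : groupType) p : finite_set [set: X] -> prime p ->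
  (forall x : X, p_elt_mod p [set 1] x) -> exists n, [set: X] #= `I_(p ^ n).
Proof.
move=> /finite_groupP[Y YX] p_pr; case: _ / YX => pY.
have pT : normal_p p [set: Y] by split.
have [|/card_pgroup cY _] := @normal_p_pgroup Y p setT [set: Y]%G _ p_pr pT.
  by move=> x; rewrite finset.in_setT.
exists (logn p #|Y|); have := card_finType Y; rewrite -{1}cardsT.
by rewrite cY cardsT.
Qed.

Lemma profinite_discrete (T : topologicalGroupType) :
  (forall U : set T, open U) -> finite_set [set: T] -> profinite T.
Proof.
move=> dT finT; split.
- exact: finite_compact.
- have nd (z : T) : nbhs z [set z] by apply: open_nbhs_nbhs; split.
  by move=> p q /(_ _ _ (nd p) (nd q))[x [/= <- <-]].
apply: zero_dimension_totally_disconnected => x y /eqP xy.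
exists [set x]; split=> //; last by move=> /esym.
by split=> //; rewrite -[[set x]]setCK; exact: open_closedC.
Qed.

(** On an infinite space the cofinite filter is proper, but it cannot cluster at [x]: the complement
    of the open set [[set x]] belongs to it. *)
Lemma compact_discrete_finite (T : topologicalType) : compact [set: T] ->
  (forall U : set T, open U) -> finite_set [set: T].
Proof.
move=> cT dT; apply: contrapT => infT.
pose F := [set A : set T | finite_set (~` A)].
have FF : ProperFilter F.
  split; first by rewrite /F /= setC0.
  split; first by rewrite /F /= setCT; exact: finite_set0.
    by move=> A B; rewrite /F /= setCI => fA fB; rewrite finite_setU.
  by move=> A B AB; apply: sub_finite_set; exact: subsetC.
have [|x [_ clx]] := cT F FF; first by rewrite /F /= setCT; exact: finite_set0.
have [||y [/= nyx yx]] := clx (~` [set x]) [set x].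
- by rewrite /F /= setCK; exact: finite_set1.
- by apply: open_nbhs_nbhs; split.
- exact: nyx.
Qed.

(** * Quotients by open normal subgroups *)

Section QuotientMorphism.
Variables (G : topologicalGroupType) (K : normal_subgroup G).
Local Notation Q := (quotient_group K).
Local Notation pi := (coset_map K).

Lemma coset_mapF : {morph pi : x y / x / y}.
Proof. by move=> x y; rewrite coset_mapM coset_mapV. Qed.

HB.instance Definition _ :=
  isGroupMorphism.Build G Q (@coset_map G K) coset_mapF.

Lemma coset_mapMg x y : pi (x * y) = pi x * pi y. Proof. exact: gmulfM. Qed.

Lemma coset_mapVg x : pi x^-1 = (pi x)^-1. Proof. exact: gmulfV. Qed.

Lemma coset_mapXg x n : pi (x ^+ n) = pi x ^+ n. Proof. exact: gmulfXn. Qed.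

Lemma coset_mapJg x y : pi (x ^ y) = pi x ^ pi y. Proof. exact: gmulfJ. Qed.

Lemma coset_mapRg x y : pi [~ x, y] = [~ pi x, pi y].
Proof. exact: gmulfR. Qed.

Lemma coset_map1P x : pi x = 1 <-> (K : set G) x.
Proof.
have -> : 1 = pi 1 by [].
split=> [/esym/coset_mapP|Kx]; first by rewrite invg1 mul1g.
by apply/esym/coset_mapP; rewrite invg1 mul1g.
Qed.

Lemma coset_map_surj (a : Q) : exists x, a = pi x.
Proof. by exists (repr a); rewrite coset_map_repr. Qed.

Lemma coset_map_eq x y : pi x = pi y -> exists2 k, (K : set G) k & x = y * k.
Proof.
by move=> /esym/coset_mapP Kk; exists (y^-1 * x) => //; rewrite mulVKg.
Qed.

Hypothesis oK : open (K : set G).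

Lemma coset_preimage_open (U : set Q) : open (pi @^-1` U).
Proof.
have [K1 _ _] := subgroupP K.
rewrite openE => x Ux; have : nbhs x (fun y => (K : set G) (x^-1 * y)).
  apply: (@mulgl_continuous G x^-1 x K); rewrite mulVg.
  exact: open_nbhs_nbhs.
by apply: filterS => y /coset_mapP xy; rewrite /= -xy.
Qed.

Lemma coset_preimage_closed (U : set Q) : closed (pi @^-1` U).
Proof.
rewrite -[X in closed X]setCK preimage_setC.
exact/open_closedC/coset_preimage_open.
Qed.

Lemma quotient_discrete (U : set Q) : open U.
Proof. by apply/quotient_openE; exact: coset_preimage_open. Qed.

Lemma quotient_closed (U : set Q) : closed U.
Proof. by rewrite -[U]setCK; exact/open_closedC/quotient_discrete. Qed.

Lemma quotient_finite : compact [set: G] -> finite_set [set: Q].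
Proof.
move=> cG; apply: compact_discrete_finite quotient_discrete.
have -> : [set: Q] = pi @` setT.
  by apply/seteqP; split=> // a _; have [x ->] := coset_map_surj a; exists x.
apply: continuous_compact => //; apply: continuous_subspaceT.
exact: coset_map_continuous.
Qed.

Lemma quotient_profinite : compact [set: G] -> profinite Q.
Proof.
by move=> /quotient_finite; apply: profinite_discrete; exact: quotient_discrete.
Qed.

Lemma open_normal_closed : closed (K : set G).
Proof.
have -> : (K : set G) = pi @^-1` [set 1].
  by apply/seteqP; split=> x /coset_map1P.
exact: coset_preimage_closed.
Qed.

End QuotientMorphism.

Lemma closed_set1 (T : topologicalType) (x : T) :
  hausdorff_space T -> closed [set x].
Proof. by move/hausdorff_accessible/accessible_closed_set1. Qed.

(** * Closed subgroups with the induced topology *)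

Section ClosedSubgroup.
Variables (G : topologicalGroupType) (H : subgroup G).
Hypotheses (profG : profinite G) (cH : closed (H : set G)).
Local Notation S := (subgroup_type H).

Lemma subgroup_nbhsP (s : S) (U : set S) : nbhs s U ->
  exists2 W, nbhs (val s) W & val @^-1` W `<=` U.
Proof.
rewrite nbhsE => -[V [[W oW <-] Ws] VU]; exists W => //.
by apply: open_nbhs_nbhs.
Qed.

Lemma val_in (s : S) : (H : set G) (val s). Proof. exact: set_mem (valP s). Qed.

Lemma subgroup_lift x : (H : set G) x -> exists s : S, val s = x.
Proof.
by move=> Hx; exists (Sub x (mem_set Hx)); rewrite SubK.
Qed.

Lemma subgroup_valM (s t : S) : val (s * t) = val s * val t.
Proof. exact: gmulfM. Qed.

Lemma subgroup_valX (s : S) n : val (s ^+ n) = val s ^+ n.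
Proof. exact: gmulfXn. Qed.

Lemma subgroup_valJ (s t : S) : val (s ^ t) = val s ^ val t.
Proof. exact: gmulfJ. Qed.

Lemma subgroup_valR (s t : S) : val [~ s, t] = [~ val s, val t].
Proof. exact: gmulfR. Qed.

Lemma subgroup_compact : compact [set: S].
Proof.
have [cG _ _] := profG => F PF _.
have cHc : compact (H : set G) by exact: subclosed_compact cH cG _.
have [|x [Hx clx]] := cHc (val @ F) _.
  by apply: (@filterE _ F) => s; exact: (val_in s).
have [s sx] := subgroup_lift Hx; exists s; split=> // A B FA.
move=> /subgroup_nbhsP[W nW WB]; rewrite sx in nW.
have FvA : (val @ F) (val @` A) 
  by apply: (@filterS _ F _ A) FA => t At; exists t.
have [_ [[t At <-] Wt]] := clx _ _ FvA nW.
by exists t; split=> //; exact: WB.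
Qed.

Lemma subgroup_profinite : profinite S.
Proof.
have [cG hG dG] := profG; split; first exact: subgroup_compact.
  move=> s t clst; apply: val_inj; apply: hG => A B nA nB.
  have [||u [Au Bu]] := clst (val @^-1` A) (val @^-1` B).
  - exact: subgroup_val_continuous.
  - exact: subgroup_val_continuous.
  - by exists (val u).
apply: zero_dimension_totally_disconnected => s t /eqP st.
have [|C [[oC cC] Cs Ct]] :=
  @compact_clopen_nbhs G (val s) (~` [set val t]) cG hG dG.
  apply: open_nbhs_nbhs; split; first exact/closed_openC/closed_set1.
  by move=> /val_inj.
exists (val @^-1` C); split=> //; last by move=> /Ct; exact.
split; first by apply: open_comp => // x _; exact: subgroup_val_continuous.
by apply: closed_comp => // x _; exact: subgroup_val_continuous.
Qed.

Lemma val_closed (A : set S) : closed A -> closed (val @` A).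
Proof.
have [_ hG _] := profG => cA; apply: compact_closed => //.
apply: continuous_compact; last exact: subclosed_compact cA subgroup_compact _.
by apply: continuous_subspaceT; exact: subgroup_val_continuous.
Qed.

Lemma val_preimage_closed (A : set G) : closed A -> closed (val @^-1` A : set S).
Proof. by apply: closed_comp => x _; exact: subgroup_val_continuous. Qed.

Lemma val_preimage_subgroup (A : set G) : is_subgroup A ->
  is_subgroup (val @^-1` A : set S).
Proof.
move=> [A1 AM AV]; split=> [|x y|x] /=; rewrite ?gmulf1 ?gmulfM ?gmulfV //.
- exact: AM.
- exact: AV.
Qed.

Lemma val_preimage_normalised (A : set G) : normalised_by A H ->
  normalised_by (val @^-1` A : set S) setT.
Proof.
move=> nA t g At _; have := nA _ _ At (val_in g).
by rewrite -gmulfJ.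
Qed.

Lemma val_image_subgroup (A : set S) : is_subgroup A -> is_subgroup (val @` A).
Proof.
move=> [A1 AM AV]; split=> [|_ _ [x Ax <-] [y Ay <-]|_ [x Ax <-]].
- by exists 1 => //; rewrite gmulf1.
- by exists (x * y); [exact: AM|rewrite gmulfM].
- by exists x^-1; [exact: AV|rewrite gmulfV].
Qed.

End ClosedSubgroup.

(** * Subgroups as topological groups *)

Section SubgroupCharacterisations.
Variables (G : topologicalGroupType) (H : subgroup G).
Hypotheses (profG : profinite G) (cH : closed (H : set G)).
Local Notation S := (subgroup_type H).

(** Together with its converse below, this trades the condition on quotients of [S] for one on
    elements of [H] modulo open normal subgroups of [G]. *)
Lemma pro_p_subgroupE p : pro_p S p -> forall x, (H : set G) x ->
  forall U : normal_subgroup G, open (U : set G) -> p_elt_mod p U x.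
Proof.
move=> [_ pS] x Hx U oU; have [s <-] := subgroup_lift Hx.
have sV := val_preimage_subgroup H (subgroupP U).
have nV : normalised_by (val @^-1` (U : set G) : set S) setT.
  by apply: val_preimage_normalised => y g Uy _; exact: normal_subgroupP.
have oV : open (val @^-1` (U : set G) : set S).
  by apply: open_comp => // t _; exact: subgroup_val_continuous.
pose V := @NormalSubgroup S (Subgroup sV) nV.
have [n cn] := pS V oV; exists n.
have := expg_card_set (coset_map V s) cn.
rewrite -coset_mapXg => /coset_map1P Vs.
have : (U : set G) (val (s ^+ (p ^ n))) by exact: Vs.
by rewrite subgroup_valX.
Qed.

(** Each open normal subgroup of [S] contains the trace of an open normal subgroup of [G], so the
    finite quotients of [S] consist of [p]-elements. *)
Lemma pro_p_subgroupI p : prime p ->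
  (forall x, (H : set G) x ->
    forall U : normal_subgroup G, open (U : set G) -> p_elt_mod p U x) ->
  pro_p S p.
Proof.
move=> p_pr pH; split=> [|V oV]; first exact: subgroup_profinite.
apply: card_p_group => //.
  by apply: quotient_finite => //; exact: subgroup_compact.
move=> a; have [s ->] := coset_map_surj a.
have [V1 _ _] := subgroupP V.
have /subgroup_nbhsP[W] : nbhs (1 : S) V by apply: open_nbhs_nbhs.
rewrite gmulf1 => /(open_normal_nbhs profG)[U [oU UW]] WV.
have [n Un] := pH _ (val_in s) U oU; exists n.
rewrite /= -coset_mapXg; apply/coset_map1P/WV/UW.
by rewrite subgroup_valX.
Qed.

Lemma closed_center : closed (center S : set S).
Proof.
have [_ hS _] := subgroup_profinite profG cH.
have -> : (center S : set S) = centraliser_set setT.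
  by apply/seteqP; split=> z cz x => [_|]; exact: cz.
exact: centraliser_closed.
Qed.

(** For the last clause, simplicity is applied to the image [P] of [N] modulo the centre. If [P] is
    trivial, [N] is central; if [P] is everything, [S = M Z], so all commutators lie in [M] and
    perfection gives [M = S]. *)
Lemma quasisimple_subgroupE : quasisimple S -> quasisimple_set closed (H : set G).
Proof.
have [_ hG _] := profG; have [cS hS _] := subgroup_profinite profG cH.
move=> [_ pS [[a na] simS]]; split.
- exact: subgroupP.
- move=> D cD sD commD x /subgroup_lift[s <-].
  suff : generated (range (fun z : S * S => [~ z.1, z.2])) `<=` val @^-1` D.
    by rewrite pS => /(_ s); exact.
  apply: generated_min.
  - exact: val_preimage_closed.
  - exact: val_preimage_subgroup.
  - move=> _ [[u v] _ <-]; have := commD _ _ (val_in u) (val_in v).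
    by rewrite -subgroup_valR.
- have [s sa] := coset_map_surj a; apply: contrapT => noxy; apply: na.
  rewrite sa; apply/coset_map1P => t; apply: val_inj; rewrite !subgroup_valM.
  apply: contrapT => nst; apply: noxy; exists (val s), (val t).
  by split=> //; exact: val_in.
move=> N cN sN NH nN.
pose Z := center S; have sZ := subgroupP Z; have nZ := @normal_subgroupP _ Z.
have sM := val_preimage_subgroup H sN.
have nM := val_preimage_normalised nN.
set M : set S := val @^-1` N in sM nM.
pose P := [set u : quotient_group Z | exists2 s, M s & u = coset_map Z s].
have sP : is_subgroup P.
  have [M1 MM MV] := sM; split.
  - by exists 1.
  - move=> _ _ [s Ms ->] [t Mt ->].
    by exists (s * t); [exact: MM|rewrite coset_mapMg].
  - by move=> _ [s Ms ->]; exists s^-1; [exact: MV|rewrite coset_mapVg].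
have nP : normalised_by (Subgroup sP) setT.
  move=> _ g [s Ms ->] _; have [t ->] := coset_map_surj g.
  by exists (s ^ t); [exact: nM|rewrite coset_mapJg].
have PE s : P (coset_map Z s) <-> exists m z, [/\ M m, (Z : set S) z & s = m * z].
  split=> [[m Mm /coset_map_eq[z Zz ->]]|[m [z [Mm Zz ->]]]].
    by exists m, z.
  exists m => //; rewrite coset_mapMg (_ : coset_map Z z = 1) ?mulg1 //.
  exact/coset_map1P.
(* The preimage of [P] is [M Z], a compact set as the image of a product of compact sets under
   multiplication. *)
have cP : closed (Subgroup sP : set (quotient_group Z)).
  rewrite -[X in closed X]setCK; apply: open_closedC; apply/quotient_openE.
  rewrite -preimage_setC; apply: closed_openC.
  have -> : coset_map Z @^-1` Subgroup sP =
      (fun z : S * S => z.1 * z.2) @` (M `*` (Z : set S)).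
    apply/seteqP; split=> [s /PE[m [z [Mm Zz ->]]]|_ [[m z] [Mm Zz] <-]].
      by exists (m, z).
    by apply/PE; exists m, z.
  apply: compact_closed => //; apply: continuous_compact.
    by apply: continuous_subspaceT; exact: mulg_continuous.
  apply: compact_setX.
    exact: subclosed_compact (val_preimage_closed cN) cS _.
  exact: subclosed_compact closed_center cS _.
case: (simS (NormalSubgroup nP) cP) => [P1|PT].
  left=> x y Nx Hy; have [s sx] := subgroup_lift (NH _ Nx).
  have [t ty] := subgroup_lift Hy.
  have : (Subgroup sP : set _) (coset_map Z s).
    by exists s => //; rewrite /M /= sx.
  rewrite P1 => /coset_map1P/(_ t)/(congr1 val).
  by rewrite !subgroup_valM sx ty.
right=> _ /subgroup_lift[s <-].
suff : M s by [].
suff : generated (range (fun z : S * S => [~ z.1, z.2])) `<=` M.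
  by rewrite pS => /(_ s); exact.
apply: generated_min => //.
  exact: val_preimage_closed.
move=> _ [[x y] _ <-] /=.
have /PE[m [z [Mm Zz ->]]] : (Subgroup sP : set _) (coset_map Z x) by rewrite PT.
have [_ MM MV] := sM.
have -> : [~ m * z, y] = [~ m, y].
  rewrite commMgE; have /commgP/eqP -> : commute z y by exact: Zz.
  by rewrite mulg1; apply/conjg_fixP/commgP/commute_sym; exact: Zz.
by rewrite commgEl; apply: (MM); [exact: MV|exact: nM].
Qed.

Lemma quasisimple_subgroupI : quasisimple_set closed (H : set G) -> quasisimple S.
Proof.
have [_ hG _] := profG; have pS := subgroup_profinite profG cH.
move=> [sH pH [x [y [Hx Hy nxy]]] dH]; split=> //.
- apply/seteqP; split=> // s _ D [[cD sD] commD].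
  have /(_ _ (val_in s))[] : (H : set G) `<=` val @` D; last first.
    by move=> t Dt /val_inj <-.
  apply: pH; [exact: val_closed|exact: val_image_subgroup|].
  move=> _ _ /subgroup_lift[u <-] /subgroup_lift[v <-].
  by exists [~ u, v]; [apply: commD; exists (u, v)|rewrite subgroup_valR].
split.
  have [s sx] := subgroup_lift Hx; have [t ty] := subgroup_lift Hy.
  exists (coset_map _ s) => /coset_map1P/(_ t)/(congr1 val).
  by rewrite !subgroup_valM sx ty.
move=> N cN; pose M := coset_map (center S) @^-1` N.
have [N1 NM NV] := subgroupP N.
have sM : is_subgroup M.
  split=> [|u v|u]; rewrite /M /= ?coset_mapMg ?coset_mapVg //.
    exact: NM.
  exact: NV.
have cM : closed M by apply: closed_comp => // u _; exact: coset_map_continuous.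
case: (dH (val @` M)) => [||_ [s _ <-]|_ g [s Ms <-]|cMH|HM].
- exact: val_closed.
- exact: val_image_subgroup.
- exact: val_in.
- move=> /subgroup_lift[t <-]; exists (s ^ t); last by rewrite subgroup_valJ.
  by rewrite /M /= coset_mapJg; exact: normal_subgroupP.
- left; apply/seteqP; split=> [a|_ ->] //; have [s ->] := coset_map_surj a => Ns.
  apply/coset_map1P => t; apply: val_inj; rewrite !subgroup_valM.
  by apply: cMH; [exists s|exact: val_in].
right; apply/seteqP; split=> // a _; have [s ->] := coset_map_surj a.
by have [t Mt /val_inj <-] := HM _ (val_in s).
Qed.

End SubgroupCharacterisations.

(** * The generalised Fitting subgroup of a quotient *)

Lemma subnormal_subnormal_in (T : topologicalGroupType) (H : set T) :
  subnormal H -> subnormal_in H setT.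
Proof.
move=> [n [c [c0 cn cc nc]]].
have sub k : (k <= n)%N -> subnormal_in H (c (n - k)%N).
  elim: k => [|k IHk] kn; first by rewrite subn0 cn; exact: subnormal_refl.
  have nk : (n - k = (n - k.+1).+1)%N by rewrite subnSK.
  have lt : (n - k.+1 < n)%N by rewrite -nk leq_subr.
  have := IHk (ltnW kn); rewrite nk => snk.
  have [_ sc] := cc _ lt; have [sub nor] := nc _ lt.
  exact: subnormal_step snk.
by have := sub n (leqnn n); rewrite subnn c0.
Qed.

Lemma generalised_Fitting_min (T : topologicalGroupType) (D : set T) :
  closed D -> is_subgroup D ->
  (forall p (N : normal_subgroup T), prime p -> closed (N : set T) ->
     pro_p (subgroup_type N) p -> N `<=` D) ->
  (forall Q : subgroup T, component Q -> Q `<=` D) ->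
  generalised_Fitting T `<=` D.
Proof.
move=> cD sD ND QD; apply: generated_min => //; rewrite subUset; split.
  apply: generated_min => //; apply: bigcup_sub => p p_pr.
  apply: generated_min => //; apply: bigcup_sub => N [cN pN].
  exact: ND p_pr cN pN.
by apply: generated_min => //; apply: bigcup_sub => Q; exact: QD.
Qed.

Lemma pro_p_sub_generalised_Fitting (T : topologicalGroupType) p
  (N : normal_subgroup T) : prime p -> closed (N : set T) ->
  pro_p (subgroup_type N) p -> N `<=` generalised_Fitting T.
Proof.
move=> p_pr cN pN x Nx; apply: sub_generated; left.
apply: sub_generated; exists p => //.
by apply: sub_generated; exists N.
Qed.

Lemma component_sub_generalised_Fitting (T : topologicalGroupType)
  (Q : subgroup T) : component Q -> Q `<=` generalised_Fitting T.
Proof.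
move=> cQ x Qx; apply: sub_generated; right.
by apply: sub_generated; exists Q.
Qed.

Lemma Fitting_hull_subgroup (T : groupType) : is_subgroup (@Fitting_hull T).
Proof.
split=> [D [D1 _ _] _ _ //|x y Fx Fy D sD ND QD|x Fx D sD ND QD].
  by have [_ DM _] := sD; apply: DM; [exact: Fx|exact: Fy].
by have [_ _ DV] := sD; apply: DV; exact: Fx.
Qed.

Lemma quasisimple_setT (T : topologicalGroupType) (Q : set T) :
  (forall U : set T, closed U) ->
  quasisimple_set closed Q -> quasisimple_alg Q.
Proof.
move=> cT [sQ pQ nQ dQ]; split=> // [D _|N _]; [exact: pQ|exact: dQ].
Qed.

Section QuotientFitting.
Variables (G : topologicalGroupType) (K : normal_subgroup G).
Hypotheses (profG : profinite G) (oK : open (K : set G)).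
Local Notation X := (quotient_group K).
Local Notation pi := (coset_map K).

Lemma coset_preimage_subgroup (A : set X) : is_subgroup A ->
  is_subgroup (pi @^-1` A).
Proof.
move=> [A1 AM AV]; split=> // [x y|x]; rewrite /preimage /mkset.
  by rewrite coset_mapMg; exact: AM.
by rewrite coset_mapVg; exact: AV.
Qed.

Lemma coset_image_subgroup (A : set G) : is_subgroup A ->
  is_subgroup (pi @` A).
Proof.
move=> [A1 AM AV]; split=> [|_ _ [x Ax <-] [y Ay <-]|_ [x Ax <-]].
- by exists 1.
- by exists (x * y); [exact: AM|exact: coset_mapMg].
- by exists x^-1; [exact: AV|exact: coset_mapVg].
Qed.

Lemma coset_image_normalised (A R : set G) : normalised_by A R ->
  normalised_by (pi @` A) (pi @` R).
Proof.
move=> nA _ _ [x Ax <-] [g Rg <-].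
by exists (x ^ g); [exact: nA|exact: coset_mapJg].
Qed.

Lemma coset_imageT : pi @` setT = setT.
Proof.
by apply/seteqP; split=> // a _; have [x ->] := coset_map_surj a; exists x.
Qed.

Lemma coset_preimage_normalised (A : set X) (R : set G) :
  normalised_by A (pi @` R) -> normalised_by (pi @^-1` A) R.
Proof.
move=> nA x g Ax Rg; rewrite /preimage /mkset coset_mapJg.
by apply: nA => //; exists g.
Qed.

Let profX : profinite X.
Proof. by have [cG _ _] := profG; exact: quotient_profinite. Qed.

Lemma image_subnormal (H : set G) : subnormal H -> subnormal (pi @` H).
Proof.
move=> [n [c [c0 cn cc nc]]]; exists n, (fun i => pi @` c i); split.
- by rewrite c0 coset_imageT.
- by rewrite cn.
- move=> i /cc[_ sc]; split; first exact: quotient_closed.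
  exact: coset_image_subgroup.
- move=> i /nc[sc nci]; split; first exact: image_subset.
  exact: coset_image_normalised.
Qed.

(** If the image of [Q] is abelian, the closed subgroup [K] contains all commutators of [Q], hence
    [Q]. Otherwise every test subgroup of the image is pulled back to [Q]. *)
Lemma image_quasisimple (Q : set G) : closed Q -> quasisimple_set closed Q ->
  Q `<=` K \/ quasisimple_set closed (pi @` Q).
Proof.
move=> cQ [sQ pQ [x [y [Qx Qy nxy]]] dQ]; have sI := coset_image_subgroup sQ.
have [ab|nab] := pselect (forall x y, Q x -> Q y -> (K : set G) [~ x, y]).
  left; apply: pQ => //; first exact: open_normal_closed.
  exact: subgroupP.
right; split=> //.
- move=> D cD sD commD _ [z Qz <-]; apply: (pQ (pi @^-1` D)) => //.
  + exact: coset_preimage_closed.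
  + exact: coset_preimage_subgroup.
  + move=> u v Qu Qv; rewrite /preimage /mkset coset_mapRg.
    by apply: commD; [exists u|exists v].
- apply: contrapT => nouv; apply: nab => u v Qu Qv.
  apply/coset_map1P; rewrite coset_mapRg; apply/eqP/commgP.
  apply: contrapT => nuv; apply: nouv; exists (pi u), (pi v).
  by split; [exists u|exists v|].
move=> N cN sN NQ nN; case: (dQ (pi @^-1` N `&` Q)) => [||||cNQ|QN].
- by apply: closedI => //; exact: coset_preimage_closed.
- by apply: is_subgroupI => //; exact: coset_preimage_subgroup.
- exact: subIsetr.
- apply: normalised_byI; last exact: normalised_by_self.
  exact: coset_preimage_normalised.
- left=> a _ Na [q Qq <-]; have [z Qz za] := NQ _ Na; rewrite -za in Na *.
  by rewrite /commute -!coset_mapMg cNQ.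
- by right=> _ [q Qq <-]; have [] := QN _ Qq.
Qed.

Lemma image_generalised_Fitting x :
  generalised_Fitting G x -> generalised_Fitting X (pi x).
Proof.
suff : generalised_Fitting G `<=` pi @^-1` generalised_Fitting X by exact.
apply: generalised_Fitting_min =>
  [||p N p_pr cN pN|Q [cQ snQ /quasisimple_subgroupE qsQ]].
- exact: coset_preimage_closed.
- by apply: coset_preimage_subgroup; exact: generated_subgroup.
- have sI := coset_image_subgroup (subgroupP N).
  have nI : normalised_by (Subgroup sI) setT.
    rewrite -coset_imageT; apply: coset_image_normalised.
    exact: normal_subgroupP.
  move=> {}x Nx.
  apply: (@pro_p_sub_generalised_Fitting X p (NormalSubgroup nI)) => //.
  + exact: quotient_closed.
  + apply: pro_p_subgroupI => //; first exact: quotient_closed.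
    move=> _ [y Ny <-] U oU.
    have nU : normalised_by
        (Subgroup (coset_preimage_subgroup (subgroupP U))) setT.
      by apply: coset_preimage_normalised => ? ? ? _; exact: normal_subgroupP.
    have [|n Un] := pro_p_subgroupE pN Ny (U := NormalSubgroup nU).
      exact: coset_preimage_open.
    by exists n; rewrite -coset_mapXg.
  + by exists x.
have [QK|qsI] := image_quasisimple cQ (qsQ profG cQ).
  move=> y /QK/coset_map1P; rewrite /preimage /mkset => ->.
  by have [] := generated_subgroup (Fitting X `|` layer X).
have [sI _ _ _] := qsI.
move=> y Qy.
apply: (@component_sub_generalised_Fitting X (Subgroup sI)); last by exists y.
split; [exact: quotient_closed|exact: image_subnormal|].
by apply: quasisimple_subgroupI => //; exact: quotient_closed.
Qed.

Lemma generalised_Fitting_sub_hull :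
  generalised_Fitting X `<=` @Fitting_hull X.
Proof.
apply: generalised_Fitting_min =>
  [||p N p_pr cN pN|Q [cQ snQ /quasisimple_subgroupE qsQ]].
- exact: quotient_closed.
- exact: Fitting_hull_subgroup.
- move=> x Nx D sD ND _; apply: (ND p N) => //; split; first exact: subgroupP.
    exact: normal_subgroupP.
  (* The quotient is discrete, so the trivial subgroup is open, and being a [p]-element modulo it
     means having [p]-power order. *)
  have n1 : normalised_by (Subgroup (is_subgroup1 X)) setT.
    by move=> _ g -> _; rewrite /= conj1g.
  move=> y Ny; apply: (pro_p_subgroupE pN Ny (U := NormalSubgroup n1)).
  exact: quotient_discrete.
move=> x Qx D sD _ QD; apply: (QD Q) => //; last exact: subnormal_subnormal_in.
by apply: quasisimple_setT => [U|]; [exact: quotient_closed|exact: qsQ].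
Qed.

End QuotientFitting.

(** * Consequences of Fitting degeneracy *)

Definition normal_setI (T : groupType) (M N : normal_subgroup T) :
  normal_subgroup T :=
  @NormalSubgroup T (Subgroup (is_subgroupI (subgroupP M) (subgroupP N)))
    (normalised_byI (@normal_subgroupP _ M) (@normal_subgroupP _ N)).

Definition normal_setT (T : groupType) : normal_subgroup T :=
  @NormalSubgroup T (Subgroup (is_subgroupT T)) (fun _ _ _ _ => Logic.I).

Lemma p_elt_modI (T : groupType) p (M N : set T) x :
  is_subgroup M -> is_subgroup N ->
  p_elt_mod p (M `&` N) x <-> p_elt_mod p M x /\ p_elt_mod p N x.
Proof.
move=> sM sN; split=> [[n [Mx Nx]]|[[m Mx] [n Nx]]]; first by split; exists n.
exists (maxn m n); split; first exact: p_elt_modW (leq_maxl m n) Mx.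
exact: p_elt_modW (leq_maxr m n) Nx.
Qed.

Lemma p_elt_mod_coset (G : topologicalGroupType) (K : normal_subgroup G) p x :
  p_elt_mod p K x <-> p_elt_mod p [set 1] (coset_map K x).
Proof.
split=> -[n Kx]; exists n.
  by rewrite /= -coset_mapXg; exact/coset_map1P.
by apply/coset_map1P; rewrite coset_mapXg.
Qed.

(* When the index of [K] is finite, this says that the image of [R] modulo [K]
   is nilpotent. *)
Definition p_closed_mod (T : groupType) (R K : set T) : Prop :=
  forall p x y, prime p -> R x -> R y ->
    p_elt_mod p K x -> p_elt_mod p K y -> p_elt_mod p K (x * y).

Section FittingDegenerate.
Variable G : topologicalGroupType.
Hypotheses (profG : profinite G) (degG : Fitting_degenerate G).

Lemma degenerate_normal_pro_p p (N : set G) : prime p -> closed N ->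
  is_subgroup N -> normalised_by N setT ->
  (forall x, N x -> forall U : normal_subgroup G, open (U : set G) ->
     p_elt_mod p U x) -> N `<=` [set 1].
Proof.
move=> p_pr cN sN nN pN; rewrite -degG.
apply: (@pro_p_sub_generalised_Fitting G p
  (@NormalSubgroup _ (Subgroup sN) nN)) => //.
exact: pro_p_subgroupI.
Qed.

Lemma degenerate_no_component (Q : set G) : closed Q -> subnormal Q ->
  ~ quasisimple_set closed Q.
Proof.
move=> cQ snQ qsQ; have [sQ _ [x [y [Qx Qy nxy]]] _] := qsQ.
have : Q `<=` [set 1].
  rewrite -degG; apply: (@component_sub_generalised_Fitting G (Subgroup sQ)).
  by split=> //; exact: quasisimple_subgroupI.
move=> Q1; apply: nxy; rewrite (Q1 _ Qx) (Q1 _ Qy); exact: commute_refl.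
Qed.

Lemma open_normal_exponent (K : normal_subgroup G) : open (K : set G) ->
  exists2 e, (0 < e)%N & forall x, (K : set G) (x ^+ e).
Proof.
move=> oK; have [cG _ _] := profG.
have /finite_setP[e ce] := quotient_finite oK cG; exists e.
  case: e ce => //; rewrite II0 card_eq0 => /eqP T0.
  by have : set0 (1 : quotient_group K) by rewrite -T0.
by move=> x; apply/coset_map1P; rewrite coset_mapXg; exact: expg_card_set.
Qed.

(** Take for [p] the least prime divisor of the order of [x] modulo [K], and that order divided by
    [p] as exponent. *)
Lemma exists_p_elt (K : normal_subgroup G) x : open (K : set G) ->
  ~ (K : set G) x ->
  exists p m, [/\ prime p, ~ (K : set G) (x ^+ m) & (K : set G) (x ^+ (m * p))].
Proof.
move=> oK nKx; have [e0 e0_gt0 Ke0] := open_normal_exponent oK.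
have exe : exists e, (0 < e)%N && `[< (K : set G) (x ^+ e) >].
  by exists e0; rewrite e0_gt0; exact/asboolP.
case: (ex_minnP exe) => m /andP[m0 /asboolP Km] minm.
have m1 : (1 < m)%N.
  by case: m m0 Km {minm} => [|[|m]] //; rewrite expg1.
exists (pdiv m), (m %/ pdiv m)%N; rewrite pdiv_prime // divnK ?pdiv_dvd //.
split=> // Kmp; have : (m <= m %/ pdiv m)%N.
  by apply: minm; rewrite divn_gt0 ?pdiv_gt0 // pdiv_leq //; exact/asboolP.
by rewrite leqNgt ltn_Pdiv // prime_gt1 // pdiv_prime.
Qed.

(** With [e] an exponent of [G/N], choose [m] divisible by the [p']-part of [e] and congruent to 1
    modulo [p]: the former makes [x ^+ m] a [p]-element modulo [N], the latter keeps it in the coset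
    [x K]. *)
Lemma exists_p_part (K N : normal_subgroup G) p x :
  open (N : set G) -> prime p -> (K : set G) (x ^+ p) ->
  exists m, p_elt_mod p N (x ^+ m) /\ (K : set G) (x^-1 * x ^+ m).
Proof.
move=> oN p_pr Kxp; have [e e0 Ne] := open_normal_exponent oN.
have cop : coprime p e`_(negn p).
  by rewrite (pnat_coprime (pnat_id p_pr)) // part_pnat.
pose m := chinese p e`_(negn p) 1 0.
have mp : m = 1 %[mod p] by apply: chinese_modl.
have /dvdnP[k mk] : e`_(negn p) %| m.
  by rewrite /dvdn; have := chinese_modr cop 1 0; rewrite mod0n => ->.
exists m; split.
  exists (logn p e); rewrite -expgnA mk -p_part -mulnA (mulnC (partn e _)) partnC //.
  rewrite mulnC expgnA.
  exact: subgroupX (subgroupP N) (Ne x).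
rewrite (divn_eq m p) mp modn_small ?prime_gt1 // addn1 expgS mulKg mulnC expgnA.
exact: subgroupX (subgroupP K) Kxp.
Qed.

(** The hypotheses make [R] pronilpotent. If [R] is nontrivial, compactness finds in it an element
    outside some [K] that is a [p]-element modulo every open normal subgroup; all such elements of
    [R] form a closed normal pro-[p] subgroup, which degeneracy forces to be trivial. *)
Lemma degenerate_p_closed (R : set G) (F : set (normal_subgroup G)) :
  closed R -> is_subgroup R -> normalised_by R setT ->
  (forall K, F K -> open (K : set G) /\ p_closed_mod R K) ->
  (forall x, R x -> (forall K : normal_subgroup G, F K -> (K : set G) x) ->
     x = 1) ->
  R `<=` [set 1].
Proof.
move=> cR sR nR FK F1 x0 Rx0; apply: contrapT => /= x01.
have [cG _ _] := profG; have [R1 RM RV] := sR.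
pose D := [set M : normal_subgroup G | open (M : set G) /\ p_closed_mod R M].
have DI M N : D M -> D N -> D (normal_setI M N).
  move=> [oM pM] [oN pN]; split; first exact: openI.
  move=> p x y p_pr Rx Ry /p_elt_modI-/(_ (subgroupP M) (subgroupP N))[Mx Nx].
  move=> /p_elt_modI-/(_ (subgroupP M) (subgroupP N))[My Ny].
  apply/(p_elt_modI _ _ (subgroupP M) (subgroupP N)).
  by split; [exact: pM|exact: pN].
have DT : D (normal_setT G) by split=> [|p x y]; [exact: openT|exists 0%N].
(* [D] is closed under intersection and meets [R] trivially in total, so by compactness the traces
   on [R] of its members are cofinal among those of open normal subgroups. *)
have sub (N : normal_subgroup G) : open (N : set G) ->
    exists2 M : normal_subgroup G, D M & R `&` M `<=` N.
  move=> oN; apply: contrapT => noM.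
  have [|||y fy] :=
    @compact_directed G _ D (fun M => R `&` M `&` ~` (N : set G)) cG.
  - by exists (normal_setT G).
  - move=> M DM; split.
      apply: closedI; last exact: open_closedC.
      by apply: closedI => //; apply: open_normal_closed; case: DM.
    apply: contrapT => ne; apply: noM; exists M => // y [Ry My].
    by apply: contrapT => nNy; apply: ne; exists y.
  - move=> M M' DM DM'; exists (normal_setI M M'); first exact: DI.
    by move=> y [[Ry [My M'y]] nNy].
  have [[Ry _] nNy] := fy _ DT; apply: nNy.
  rewrite (F1 y Ry); first by case: (subgroupP N).
  by move=> K /FK DK; have [[]] := fy _ DK.
have [K FKK nKx0] : exists2 K, F K & ~ (K : set G) x0.
  apply: contrapT => noK; apply: x01; apply: F1 => // K FKK.
  by apply: contrapT => nKx; apply: noK; exists K.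
have [oK _] := FK _ FKK.
have [p [m [p_pr nKx Kxp]]] := exists_p_elt oK nKx0.
set x := x0 ^+ m in nKx; rewrite expgnA -/x in Kxp.
have Rx : R x by exact: subgroupX.
(* A point common to all [f N] is a [p]-element modulo every [N] and lies in the nontrivial coset
   [x K]. *)
pose f (N : normal_subgroup G) :=
  R `&` [set y | p_elt_mod p N y] `&` [set y | (K : set G) (x^-1 * y)].
have clp (N : normal_subgroup G) : open (N : set G) ->
    closed [set y | p_elt_mod p N y].
  move=> oN; rewrite (_ : mkset _ =
    coset_map N @^-1` [set a | p_elt_mod p [set 1] a]).
    exact: coset_preimage_closed.
  by apply/seteqP; split=> y /p_elt_mod_coset.
have [|||y fy] := @compact_directed G _
  [set N : normal_subgroup G | open (N : set G)] f cG.
- by exists (normal_setT G); exact: openT.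
- move=> N oN; split.
    apply: closedI; first by apply: closedI => //; exact: clp.
    rewrite (_ : mkset _ = coset_map K @^-1` [set coset_map K x]).
      exact: coset_preimage_closed.
    by apply/seteqP; split=> y; [move/coset_mapP|move/esym/coset_mapP].
  have [k [pk Kk]] := exists_p_part oN p_pr Kxp.
  by exists (x ^+ k); split=> //; split=> //; exact: subgroupX.
- move=> M N oM oN; exists (normal_setI M N); first exact: openI.
  move=> y [[Ry /p_elt_modI-/(_ (subgroupP M) (subgroupP N))[My Ny]] Ky].
  by split; split.
(* The normal pro-[p] subgroup: closure under products comes from [p]-closedness modulo members of
   [D], carried to every open [N] by [sub]. *)
pose S := R `&` \bigcap_(N in [set N : normal_subgroup G | open (N : set G)])
  [set y | p_elt_mod p N y].
have oT : open (normal_setT G : set G) by exact: openT.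
have Sy : S y.
  by split=> [|N oN]; [have [[]] := fy _ oT|have [[]] := fy _ oN].
have S1 : S `<=` [set 1].
  apply: (degenerate_normal_pro_p p_pr).
  - by apply: closedI => //; apply: closed_bigI => N oN; exact: clp.
  - split.
    + by split=> // N _; exists 0%N; rewrite expg1n; case: (subgroupP N).
    + move=> u v [Ru pu] [Rv pv]; split; first exact: RM.
      move=> N oN; have [M [oM pM] RMN] := sub N oN.
      have [n Mn] := pM p u v p_pr Ru Rv (pu _ oM) (pv _ oM).
      by exists n; apply: RMN; split=> //; apply: subgroupX => //; exact: RM.
    + move=> u [Ru pu]; split=> [|N oN]; first exact: RV.
      have [n Nn] := pu _ oN; exists n; rewrite expVgn.
      by have [_ _ NV] := subgroupP N; exact: NV.
  - move=> u g [Ru pu] _; split=> [|N oN]; first exact: nR.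
    have [n Nn] := pu _ oN; exists n; rewrite -conjXg.
    exact: normal_subgroupP.
  - by move=> u [_ pu] U oU; exact: pu.
have [_ Ky] := fy _ oT.
apply: nKx; have [_ _ KV] := subgroupP K.
by move: Ky; rewrite /= (S1 y Sy) mulg1 => /KV; rewrite invgK.
Qed.

End FittingDegenerate.

(** * Conjugation invariance of the Fitting hull *)

Section Conjugation.
Variables (T : groupType) (h : T).
Implicit Types (A Q N Y : set T).

(** The conjugate of [A] by [g^-1], written as a preimage so that membership needs no witness. *)
Definition conj_preimage A (g : T) : set T := [set y | A (y ^ g)].

Lemma conj_preimage_subgroup A g : is_subgroup A ->
  is_subgroup (conj_preimage A g).
Proof.
move=> [A1 AM AV]; split=> [|x y Ax Ay|x Ax]; rewrite /conj_preimage /mkset.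
- by rewrite conj1g.
- by rewrite conjMg; exact: AM.
- by rewrite conjVg; exact: AV.
Qed.

Lemma conj_preimage_normalised A Y g : normalised_by A Y ->
  normalised_by (conj_preimage A g) (conj_preimage Y g).
Proof.
by move=> nA x y Ax Yy; rewrite /conj_preimage /mkset conjJg; exact: nA.
Qed.

Lemma conj_preimage_subnormal Q Y g : subnormal_in Q Y ->
  subnormal_in (conj_preimage Q g) (conj_preimage Y g).
Proof.
elim=> [|{}Y Y1 sY1 Y1Y nY1 _ IH]; first exact: subnormal_refl.
apply: subnormal_step IH; first exact: conj_preimage_subgroup.
- by move=> x; exact: Y1Y.
- exact: conj_preimage_normalised.
Qed.

Lemma conj_preimage_quasisimple Q g : quasisimple_alg Q ->
  quasisimple_alg (conj_preimage Q g).
Proof.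
move=> [sQ pQ [x [y [Qx Qy nxy]]] dQ].
have QJ z : Q z -> conj_preimage Q g (z ^ g^-1).
  by rewrite /conj_preimage /mkset conjgKV.
split; first exact: conj_preimage_subgroup.
- move=> D _ sD commD z Qz; rewrite -(conjgK g z).
  apply: (pQ (conj_preimage D g^-1)) Qz => //; first exact: conj_preimage_subgroup.
  move=> u v Qu Qv; rewrite /conj_preimage /mkset conjRg.
  by apply: commD; exact: QJ.
- exists (x ^ g^-1), (y ^ g^-1); split; [exact: QJ|exact: QJ|].
  by move=> /(@commuteJ _ _ _ g); rewrite !conjgKV.
move=> N _ sN NQ nN; case: (dQ (conj_preimage N g^-1)) => // [|u Nu|u v Nu Qv|cNQ|QN].
- exact: conj_preimage_subgroup.
- by have := NQ _ Nu; rewrite /conj_preimage /mkset conjgKV.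
- by rewrite /conj_preimage /mkset conjJg; apply: nN => //; exact: QJ.
- left=> u v Nu Qv; rewrite -(conjgK g u) -(conjgK g v); apply: commuteJ.
  by apply: cNQ => //; rewrite /conj_preimage /mkset conjgK.
by right=> u /QN; rewrite /conj_preimage /mkset conjgK.
Qed.

(** Conjugation fixes the normal [p]-subgroups and permutes the components, hence permutes the
    subgroups [D] whose intersection is the hull. *)
Lemma Fitting_hull_normalised : normalised_by (@Fitting_hull T) setT.
Proof.
move=> x g Fx _ D sD ND QD; apply: (Fx (conj_preimage D g)).
- exact: conj_preimage_subgroup.
- move=> p N p_pr pN y Ny; apply: (ND p N p_pr pN).
  by have [_ nN _] := pN; exact: nN.
move=> Q qsQ snQ y Qy; apply: (QD (conj_preimage Q g^-1)).
- exact: conj_preimage_quasisimple.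
- exact: (conj_preimage_subnormal g^-1 snQ).
by rewrite /conj_preimage /mkset conjgK.
Qed.

End Conjugation.

Lemma core_subgroup (T : groupType) (H : subgroup T) : is_subgroup (core H).
Proof.
have [H1 HM HV] := subgroupP H; apply: is_subgroup_bigcap => g _.
split=> [|_ _ [x Hx <-] [y Hy <-]|_ [x Hx <-]].
- by exists 1 => //; rewrite conj1g.
- by exists (x * y); [exact: HM|rewrite conjMg].
- by exists x^-1; [exact: HV|rewrite conjVg].
Qed.

Lemma core_normal (T : groupType) (H : subgroup T) :
  normalised_by (core H) setT.
Proof.
move=> x g cx _ a _; have [h Hh hx] := cx (a * g^-1) I.
by exists h => //; rewrite -hx -conjgM mulgVK.
Qed.

Lemma core_sub (T : groupType) (H : subgroup T) : core H `<=` H.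
Proof. by move=> x /(_ 1 I)[h Hh <-]; rewrite conjg1. Qed.

(** * Primitive quotients and the Frattini argument for degenerate groups *)

Section Frattini.
Variable G : topologicalGroupType.
Hypotheses (profG : profinite G) (degG : Fitting_degenerate G).

Lemma core_quotient_primitive (H : subgroup G) (K : normal_subgroup G) :
  maximal_subgroup H -> (K : set G) = core H -> open (K : set G) ->
  primitive (quotient_group K).
Proof.
move=> [HT maxH] KH oK; have [cG _ _] := profG.
split; first exact: quotient_finite.
have [H1 HM HV] := subgroupP H.
have HK h k : (H : set G) h -> (K : set G) k -> (H : set G) (h * k).
  by move=> Hh Kk; apply: HM => //; apply: core_sub; rewrite -KH.
exists (Subgroup (coset_image_subgroup K (subgroupP H))); split; first split.
- move=> HKT; apply: HT; apply/seteqP; split=> // g _.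
  have : [set: quotient_group K] (coset_map K g) by [].
  by rewrite -HKT => -[h Hh /esym/coset_map_eq[k Kk ->]]; exact: HK.
- move=> M HM'; pose M' := Subgroup (coset_preimage_subgroup (subgroupP M)).
  have [h Hh|M'H|M'T] := maxH M'.
  + by apply: HM'; exists h.
  + left; apply/seteqP; split=> [a Ma|a /HM' //].
    have [g ag] := coset_map_surj a; exists g => //.
    by rewrite -M'H /= /preimage /mkset -ag.
  + right; apply/seteqP; split=> // a _; have [g ->] := coset_map_surj a.
    by have : (M' : set G) g by rewrite M'T.
apply/seteqP; split=> [a|_ ->].
  have [x ->] := coset_map_surj a => cx; apply/coset_map1P; rewrite KH => g _.
  have [_ [h Hh <-] ] := cx (coset_map K g) I.
  rewrite -coset_mapJg => /esym/coset_map_eq[k]; rewrite KH => ck ->.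
  have [h' Hh' <-] := ck g I.
  by exists (h * h'); [exact: HM|rewrite conjMg].
move=> a _; exists 1; last exact: conj1g.
by exists 1.
Qed.

(** Modulo any open normal [N], the intersection [P] of the primitive kernels lies in every maximal
    subgroup: the core of the preimage of such a subgroup is itself a primitive kernel. So [P] is
    [p]-closed modulo every [N] and [degenerate_p_closed] applies. *)
Lemma Frattini_trivial (x : G) :
  (forall K : normal_subgroup G, open (K : set G) ->
     primitive (quotient_group K) -> (K : set G) x) -> x = 1.
Proof.
pose prim := [set K : normal_subgroup G |
  open (K : set G) /\ primitive (quotient_group K)].
pose P : set G := \bigcap_(K in prim) K.
move=> Kx; have : P x by move=> K []; exact: Kx.
move: x {Kx}; have [cG hG _] := profG.
apply: (@degenerate_p_closed G profG degG P
  [set K : normal_subgroup G | open (K : set G)]).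
- by apply: closed_bigI => K [oK _]; exact: open_normal_closed.
- by apply: is_subgroup_bigcap => K _; exact: subgroupP.
- by move=> x g Px _ K pK; apply: normal_subgroupP => //; exact: Px.
- move=> N oN; split=> // p x y p_pr Px Py /p_elt_mod_coset px /p_elt_mod_coset py.
  apply/p_elt_mod_coset; rewrite coset_mapMg.
  apply: (@p_closed_Frattini _ (coset_map N @` P)) => //.
  + exact: quotient_finite.
  + move=> M [MT maxM] _ [z Pz <-].
    pose H := Subgroup (coset_preimage_subgroup (subgroupP M)).
    pose K := @NormalSubgroup G (Subgroup (core_subgroup H)) (@core_normal _ H).
    suff pK : prim K by apply: (@core_sub _ H); exact: (Pz K).
    have NK : N `<=` K.
      move=> n Nn g _; exists (n ^ g^-1); last by rewrite conjgKV.
      have /coset_map1P : (N : set G) (n ^ g^-1) by exact: normal_subgroupP.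
      rewrite /H /= /preimage /mkset => ->.
      by have [] := subgroupP M.
    have oK : open (K : set G).
      apply: open_subgroup (subgroupP K) _ NK.
      by apply: open_nbhs_nbhs; split=> //; have [] := subgroupP N.
    split=> //; apply: (@core_quotient_primitive H) => //; split.
      move=> HT; apply: MT; apply/seteqP; split=> // a _.
      have [g ->] := coset_map_surj a.
      by have : (H : set G) g by rewrite HT.
    move=> M' HM'; pose M1 := Subgroup (coset_image_subgroup N (subgroupP M')).
    have NM' : N `<=` M'.
      by move=> n Nn; apply: HM'; apply: (@core_sub _ H); exact: NK.
    have [a Ma|M1M|M1T] := maxM M1.
    * have [g ag] := coset_map_surj a; exists g => //; apply: HM'.
      by rewrite /H /= /preimage /mkset -ag.
    * left; apply/seteqP; split=> [g M'g|g /HM' //].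
      have : (M1 : set _) (coset_map N g) by exists g.
      by rewrite M1M.
    right; apply/seteqP; split=> // g _.
    have : (M1 : set _) (coset_map N g) by rewrite M1T.
    move=> [m M'm /esym/coset_map_eq[n Nn ->]].
    by have [_ MM _] := subgroupP M'; apply: MM => //; exact: NM'.
move=> x Px xK; apply: contrapT => x1.
have nx : nbhs (1 : G) (~` [set x]).
  apply: open_nbhs_nbhs; split; first exact/closed_openC/closed_set1.
  by move=> /esym.
have [N [oN Nx]] := open_normal_nbhs profG nx.
by apply: (Nx x) => //; exact: xK.
Qed.

End Frattini.

(** * The main argument *)

Section HullRadical.
Variable G : topologicalGroupType.
Hypotheses (profG : profinite G) (degG : Fitting_degenerate G).

Let prim := [set K : normal_subgroup G |
  open (K : set G) /\ primitive (quotient_group K)].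

(** Formed with [Fitting_hull] instead of the topological F*; as the hull contains F*, triviality of
    this set is enough for the theorem. *)
Definition hull_radical : set G :=
  \bigcap_(K in prim) (coset_map K @^-1` @Fitting_hull (quotient_group K)).

Local Notation R := hull_radical.

Let cG : compact [set: G]. Proof. by case: profG. Qed.
Let hG : hausdorff_space G. Proof. by case: profG. Qed.

Let cR : closed R.
Proof. by apply: closed_bigI => K [oK _]; exact: coset_preimage_closed. Qed.

Let sR : is_subgroup R.
Proof.
apply: is_subgroup_bigcap => K _; apply: coset_preimage_subgroup.
exact: Fitting_hull_subgroup.
Qed.

Let nR : normalised_by R setT.
Proof.
move=> x g Rx _ K pK; rewrite /preimage /mkset coset_mapJg.
by apply: Fitting_hull_normalised => //; exact: Rx.
Qed.

Let prim1 x : (forall K, prim K -> (K : set G) x) -> x = 1.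
Proof.
by move=> Kx; apply: (Frattini_trivial profG degG) => K oK pK; exact: Kx.
Qed.

Let imR K : prim K -> [/\ is_subgroup (coset_map K @` R),
  normalised_by (coset_map K @` R) setT &
  coset_map K @` R `<=` @Fitting_hull (quotient_group K)].
Proof.
move=> pK; split; first exact: coset_image_subgroup.
  by rewrite -coset_imageT; exact: coset_image_normalised.
by move=> _ [x Rx <-]; exact: Rx.
Qed.

(** Products of commuting [p]-elements are [p]-elements, so the centre of [R] is [p]-closed modulo
    every [K]. *)
Let center_trivial z : R z -> centraliser_set R z -> z = 1.
Proof.
move=> Rz cz; suff : R `&` centraliser_set R `<=` [set 1] by apply; split.
apply: (@degenerate_p_closed G profG degG _ prim).
- by apply: closedI => //; exact: centraliser_closed.
- by apply: is_subgroupI => //; exact: centraliser_subgroup.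
- by apply: normalised_byI => //; exact: centraliser_normalised.
- move=> K [oK _]; split=> // p x y p_pr [Rx cx] [Ry cy] [m Km] [n Kn].
  have sK := subgroupP K; have [_ KM _] := sK.
  exists (maxn m n); rewrite expgMn; last exact: cx.
  apply: KM; first exact: p_elt_modW sK (leq_maxl m n) Km.
  exact: p_elt_modW sK (leq_maxr m n) Kn.
- by move=> x _; exact: prim1.
Qed.

(** * From a component of one quotient to a component of the whole group *)

Section MainStep.
Variables (K0 : normal_subgroup G) (Q : set (quotient_group K0)).
Hypotheses (pK0 : prim K0) (qsQ : quasisimple_alg Q).
Hypothesis snQ : subnormal_in Q (coset_map K0 @` R).
Hypothesis RQC : forall r, (coset_map K0 @` R) r ->
  exists q c, [/\ Q q, centraliser_set Q c & r = q * c].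

Let L : set G := R `&` coset_map K0 @^-1` centraliser_set Q.

Let sL : is_subgroup L.
Proof.
apply: is_subgroupI => //; apply: coset_preimage_subgroup.
exact: centraliser_subgroup.
Qed.

Let LR : L `<=` R. Proof. exact: subIsetl. Qed.

Let nQ : normalised_by Q (coset_map K0 @` R).
Proof.
have [sQ _ _ _] := qsQ.
move=> x g Qx /RQC[q [c [Qq Cc ->]]]; rewrite conjgM.
have Qxq : Q (x ^ q) by exact: normalised_by_self.
suff -> : (x ^ q) ^ c = x ^ q by [].
by apply/conjg_fixP/commgP/commute_sym; exact: Cc.
Qed.

Let nL : normalised_by L R.
Proof.
apply: normalised_byI; first exact: normalised_by_self.
apply: coset_preimage_normalised; apply: centraliser_normalised => //.
exact: coset_image_subgroup.
Qed.

(** Simplicity of [R/L]. By [quasisimple_normal] the image of [A] either centralises [Q], or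
    contains [Q] and so supplies the factor [q] in the decomposition [q * c] of the image of [r]. *)
Let dich A : is_subgroup A -> A `<=` R -> normalised_by A R ->
  A `<=` L \/ forall r, R r -> exists a l, [/\ A a, L l & r = a * l].
Proof.
move=> sA AR nA; have [_ RM RV] := sR.
have [|||QA|cQA] := @quasisimple_normal _ Q (coset_map K0 @` A) _ qsQ snQ.
- exact: coset_image_subgroup.
- exact: image_subset.
- exact: coset_image_normalised.
- right=> r Rr; have [|q [c [/QA[a Aa <-] Cc rac]]] := RQC (r := coset_map K0 r).
    by exists r.
  exists a, (a^-1 * r); split=> //; last by rewrite mulVKg.
  split; first by apply: (RM) => //; apply: RV; exact: AR.
  by rewrite /preimage /mkset coset_mapMg coset_mapVg rac mulKg.
left=> a Aa; split; first exact: AR.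
by move=> q Qq; apply/commute_sym/cQA => //; exists a.
Qed.

(** If all commutators of [R] lay in [L], those of [Q] would centralise [Q], and the perfect group
    [Q] would be abelian. *)
Let nab : exists r s, [/\ R r, R s & ~ L [~ r, s]].
Proof.
have [sQ pQ [x [y [Qx Qy nxy]]] _] := qsQ.
have QR := subnormal_in_sub snQ.
apply: contrapT => ab; apply: nxy.
suff : Q `<=` centraliser_set Q by move=> /(_ x Qx); exact.
apply: pQ => //; first exact: centraliser_subgroup.
move=> u v /QR[r Rr <-] /QR[s Rs <-]; rewrite -coset_mapRg.
suff [_ cQ] : L [~ r, s] by exact: cQ.
by apply: contrapT => nLrs; apply: ab; exists r, s.
Qed.

(* Any two elements of [R] are congruent modulo [L] to elements of [A] and of
   [B], and commutators of the latter lie in the intersection. *)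
Let prime_ideal A B : is_subgroup A -> A `<=` R -> normalised_by A R ->
  is_subgroup B -> B `<=` R -> normalised_by B R ->
  A `&` B `<=` L -> A `<=` L \/ B `<=` L.
Proof.
move=> sA AR nA sB BR nB ABL.
case: (dich sA AR nA) => [|RAL]; first by left.
case: (dich sB BR nB) => [|RBL]; first by right.
have [r [s [Rr Rs []]]] := nab.
have [a [l [Aa Ll ->]]] := RAL _ Rr; have [b [m [Bb Lm ->]]] := RBL _ Rs.
apply: (commutatorM_mem sL sR) => //; [exact: AR|exact: BR|apply: ABL].
have [_ AM AV] := sA; have [_ BM BV] := sB; split.
  by rewrite commgEl; apply: (AM); [exact: AV|apply: nA => //; exact: BR].
by rewrite commgEr; apply: (BM) => //; apply: nB; [exact: BV|exact: AR].
Qed.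

Let CK K : set G :=
  R `&` coset_map K @^-1` centraliser_set (coset_map K @` L).

(** [CK K] contains the intersection of [R] and [K]. If it lay in [L], then [L] would be recovered
    from its image modulo [K], the simplicity of [R/L] would pass to that quotient, and
    [centraliser_not_sub] would yield an element of [CK K] outside [L]. *)
Let CK_not_sub K : prim K -> ~ CK K `<=` L.
Proof.
move=> pK CKL; have [_ RM RV] := sR; have [_ LM _] := sL.
have RKL : R `&` K `<=` L.
  move=> k [Rk Kk]; apply: CKL; split=> // a _.
  by rewrite (coset_map1P _ _).2 //; exact/commute_sym/commute1.
have back r : R r -> (coset_map K @` L) (coset_map K r) -> L r.
  move=> Rr [l Ll /esym/coset_map_eq[k Kk rl]]; rewrite rl; apply: LM => //.
  apply: RKL; split=> //.
  have -> : k = l^-1 * r by rewrite rl mulKg.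
  by apply: RM => //; apply: RV; exact: LR.
have [oK _] := pK; have [sRb nRb hRb] := imR pK.
have [] := @centraliser_not_sub _ (quotient_finite oK cG) _ sRb nRb hRb
  (coset_map K @` L).
- exact: coset_image_subgroup.
- exact: image_subset.
- exact: coset_image_normalised.
- have [r [s [Rr Rs nLrs]]] := nab.
  exists (coset_map K r), (coset_map K s); split; [by exists r|by exists s|].
  rewrite -coset_mapRg => /back; apply: contra_not nLrs; apply.
  by rewrite commgEl; apply: (RM); [exact: RV|exact: nR].
- move=> A sA AR nA; case: (@dich (R `&` coset_map K @^-1` A)) => [||||RAL].
  + by apply: is_subgroupI => //; exact: coset_preimage_subgroup.
  + exact: subIsetl.
  + apply: normalised_byI; first exact: normalised_by_self.
    exact: coset_preimage_normalised.
  + move=> AL; left=> a Aa; have [r Rr ra] := AR _ Aa; exists r => //.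
    by apply: AL; split=> //; rewrite /preimage /mkset ra.
  + right=> _ [r /RAL[a [l [[Ra Aa] Ll ->]]] <-].
    exists (coset_map K a), (coset_map K l).
    by split=> //; exact: coset_mapMg.
move=> _ [[r Rr <-] nLr cr]; apply: nLr; exists r => //.
by apply: CKL.
Qed.

(** By [prime_ideal] the closed normal subgroups of [R] not inside [L] are closed under
    intersection, so compactness gives one element outside [L] common to all [CK K]. It centralises
    [L] modulo every [K], and the [K] intersect trivially. *)
Lemma exists_centraliser : exists y, [/\ R y, ~ L y & centraliser_set L y].
Proof.
have [oK0 _] := pK0.
pose D := [set A : set G | [/\ closed A, is_subgroup A, A `<=` R,
  normalised_by A R & ~ A `<=` L]].
(* This is [A] minus [L]; it is closed because membership in [L] is decided within [R] modulo the
   open subgroup [K0]. *)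
pose f A := A `&` coset_map K0 @^-1` (~` centraliser_set Q).
have DCK K : prim K -> D (CK K).
  move=> pK; have [oK _] := pK; split.
  - by apply: closedI => //; exact: coset_preimage_closed.
  - apply: is_subgroupI => //; apply: coset_preimage_subgroup.
    exact: centraliser_subgroup.
  - exact: subIsetl.
  - apply: normalised_byI; first exact: normalised_by_self.
    apply: coset_preimage_normalised; apply: centraliser_normalised.
      exact: coset_image_subgroup.
    exact: coset_image_normalised.
  - exact: CK_not_sub.
have [|||y fy] := @compact_directed G _ D f cG.
- by exists (CK K0); exact: DCK.
- move=> A [cA sA AR nA AL]; split.
    by apply: closedI => //; exact: coset_preimage_closed.
  apply: contrapT => ne; apply: AL => a Aa; split; first exact: AR.
  by apply: contrapT => nCa; apply: ne; exists a.
- move=> A B [cA sA AR nA AL] [cB sB BR nB BL]; exists (A `&` B).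
    split; [exact: closedI|exact: is_subgroupI|by move=> x [/AR]| |].
      exact: normalised_byI.
    by move=> /(prime_ideal sA AR nA sB BR nB)[].
  by move=> x [[Ax Bx] nCx].
have [[Ry _] nCy] := fy _ (DCK _ pK0).
exists y; split=> //; first by case.
move=> l Ll; apply/commgP/eqP; apply: prim1 => K pK.
have [[_ cy] _] := fy _ (DCK _ pK).
apply/coset_map1P; rewrite coset_mapRg; apply/eqP/commgP.
by apply: cy; exists l.
Qed.

Let C : set G := R `&` centraliser_set L.

Lemma centraliser_component : subnormal C /\ quasisimple_set closed C.
Proof.
have [y [Ry nLy cLy]] := exists_centraliser.
have [_ RM RV] := sR; have [_ LM LV] := sL.
have sC : is_subgroup C by apply: is_subgroupI => //; exact: centraliser_subgroup.
have cC : closed C by apply: closedI => //; exact: centraliser_closed.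
have CR : C `<=` R by exact: subIsetl.
have nC : normalised_by C R.
  apply: normalised_byI; first exact: normalised_by_self.
  exact: centraliser_normalised.
have [_ CM CV] := sC.
have RCL r : R r -> exists q l, [/\ C q, L l & r = q * l].
  case: (dich sC CR nC) => [CL|]; last exact.
  by case: nLy; apply: CL.
(* An element of both [C] and [L] commutes with [C] and with [L], hence with [R = C L], whose centre
   is trivial. *)
have CL1 z : C z -> L z -> z = 1.
  move=> [Rz cLz] Lz; apply: center_trivial => // r /RCL[q [l [[_ cq] Ll ->]]].
  by apply: commuteM; [exact/commute_sym/cq|exact: cLz].
(* If [C] were abelian, [y] would be central in [R], hence trivial, although it lies outside [L]. *)
have abelian1 : (forall u v, C u -> C v -> commute u v) -> False.
  move=> ab; apply: nLy; suff -> : y = 1 by case: sL.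
  apply: center_trivial => // r /RCL[q [l [Cq Ll ->]]].
  by apply: commuteM; [exact: ab|exact: cLy].
(* [L] centralises [C], so a normal subgroup of [C] is normal in [R = C L] and [dich] applies to
   it. *)
have simC A : is_subgroup A -> A `<=` C -> normalised_by A C ->
    A `<=` [set 1] \/ C `<=` A.
  move=> sA AC nA.
  have nAR : normalised_by A R.
    move=> a r Aa /RCL[q [l [Cq Ll ->]]]; rewrite conjgM.
    have Aaq : A (a ^ q) by exact: nA.
    suff -> : (a ^ q) ^ l = a ^ q by [].
    by apply/conjg_fixP/commgP; have [_] := AC _ Aaq; apply.
  have AR : A `<=` R by exact: subset_trans CR.
  case: (dich sA AR nAR) => [AL|RAL].
    by left=> a Aa; apply: CL1; [exact: AC|exact: AL].
  right=> q Cq; have [a [l [Aa Ll qal]]] := RAL _ (CR _ Cq).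
  have Cl : C l.
    have -> : l = a^-1 * q by rewrite qal mulKg.
    by apply: (CM) => //; apply: CV; exact: AC.
  by rewrite qal (CL1 l Cl Ll) mulg1.
split.
  exists 2%N, (fun i => match i with 0 => setT | 1 => R | _ => C end); split=> //.
    by case=> [|[|i]] _; split=> //; exact: closedT.
  by case=> [|[|i]] // _; split=> //; exact: normal_subgroupP.
split=> //.
- move=> D _ sD commD; have [_ DM _] := sD.
  (* A subgroup [D] containing the commutators of [C] meets [C] in a normal subgroup, which is not
     trivial because [C] is nonabelian. *)
  case: (simC (D `&` C)) => [||x g [Dx Cx] Cg|DC1|CD].
  + exact: is_subgroupI.
  + exact: subIsetr.
  + split; last exact: normalised_by_self.
    by rewrite -(mulVKg x (x ^ g)) -commgEl; apply: DM => //; exact: commD.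
  + exfalso; apply: abelian1 => u v Cu Cv; apply/commgP/eqP; apply: DC1.
    split; first exact: commD.
    by rewrite commgEl; apply: (CM); [exact: CV|exact: normalised_by_self].
  + by move=> x /CD[].
- apply: contrapT => noxy; apply: abelian1 => u v Cu Cv.
  by apply: contrapT => nuv; apply: noxy; exists u, v.
move=> N _ sN NC nN; case: (simC N sN NC nN) => [N1|]; last by right.
left=> u v /N1 -> _; exact/commute_sym/commute1.
Qed.

Lemma no_component_in_radical : False.
Proof.
have [snC qsC] := centraliser_component.
apply: degenerate_no_component qsC => //.
by apply: closedI => //; exact: centraliser_closed.
Qed.

End MainStep.

(** [no_component_in_radical] excludes the first alternative of [component_or_p_closed]; the second
    makes [R] [p]-closed modulo every [K]. *)
Lemma hull_radical_trivial : R `<=` [set 1].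
Proof.
apply: (@degenerate_p_closed G profG degG R prim) => // [K pK|x _]; last exact: prim1.
have [oK _] := pK; split=> //; have [sRb nRb hRb] := imR pK.
case: (component_or_p_closed (quotient_finite oK cG) sRb nRb hRb).
  by move=> [Q [qsQ snQ RQC]]; case: (no_component_in_radical pK qsQ snQ RQC).
move=> pcl p x y p_pr Rx Ry /p_elt_mod_coset px /p_elt_mod_coset py.
apply/p_elt_mod_coset; rewrite coset_mapMg.
exact: pcl px py.
Qed.

End HullRadical.

Theorem theoremD (G : topologicalGroupType) (profG : profinite G)
    (ntG : exists x : G, x <> 1) :
  Fitting_degenerate G <->
  forall x : G, x <> 1 ->
    exists K : normal_subgroup G,
      [/\ open (K : set G), primitive (quotient_group K) &
          ~ generalised_Fitting (quotient_group K) (coset_map K x)].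
Proof.
split=> [degG x x1|sep].
  apply: contrapT => noK; apply: x1; apply: (hull_radical_trivial profG degG).
  move=> K [oK pK]; apply: generalised_Fitting_sub_hull => //.
  by apply: contrapT => nx; apply: noK; exists K.
apply/seteqP; split=> [x Fx|_ ->]; last first.
  by case: (generated_subgroup (Fitting G `|` layer G)).
apply: contrapT => /sep[K [oK _]]; apply.
exact: image_generalised_Fitting.
Qed.
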